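(* Any maximal submodule of $M(\eta)$ is one of: (a) $W(\eta;\kappa,c)$ with $(\kappa,c)$ non-critical; (b) $\widehat W_-(\eta;\kappa,c)$ with $(\kappa,c)$ critical.
   Context: Let $q\in\mathbb{C}$ be nonzero and not a root of unity, and $U=U_q(\mathfrak{sl}_3)$ the algebra generated by $E_1,E_2,F_1,F_2,K_1^{\pm1},K_2^{\pm1}$ with the Jimbo relations. Put $F_3=F_1F_2-qF_2F_1$, $K=K_1K_2^2$, $C_1=F_1E_1+\frac{qK_1+q^{-1}K_1^{-1}}{(q-q^{-1})^2}$. Let $U^+$ be the subalgebra generated by $E_1,E_2$, $\eta:U^+\to\mathbb{C}$ the algebra homomorphism with $\eta(E_1)=\alpha\neq0$, $\eta(E_2)=0$, and $M(\eta)=U\otimes_{U^+}\mathbb{C}v_\eta$ with $xv_\eta=\eta(x)v_\eta$. Write $[k]=\frac{q^k-q^{-k}}{q-q^{-1}}$, $[k]!=[k]\cdots[1]$, $[0]!=1$, $\genfrac{[}{]}{0pt}{}{n}{k}=\frac{[n]!}{[k]![n-k]!}$ for $0\le k\le n$ (0 otherwise). For $n\in\mathbb{Z}_+$, $l\in\mathbb{Z}$, $Q\in\mathbb{C}[K^{\pm1},C_1]$, $u(n,l,Q)=q^{2nl}K_2^l\sum_{k=0}^{n}\sum_{j=0}^{n-k}a_{kj}(n)F_2^{n-k}F_3^kK_2^{2j}K^{-2j-k}Qv_\eta$ with $a_{kj}(n)=(-1)^j\alpha^k(q^2-1)^kq^{j(n-3)}q^{\frac{1}{2}k(2n+2j+k-7)}\genfrac{[}{]}{0pt}{}{n}{k}\genfrac{[}{]}{0pt}{}{n-k}{j}$.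 For $n\in\mathbb{N}$, $h_n(K,C_1)=q^{3-2n}K+q^{2n-3}K^{-1}-(q-q^{-1})^2C_1$; $(\kappa,c)\in\mathbb{C}^2$, $\kappa\ne0$, is critical if $h_n(\kappa,c)=0$ for some $n\in\mathbb{N}$ and non-critical otherwise; for critical $(\kappa,c)$, $n_-$ denotes the smallest such $n$. $J(\kappa,c)$ is the ideal of $\mathbb{C}[K^{\pm1},C_1]$ generated by $K-\kappa$, $C_1-c$; $W(\eta;\kappa,c)=UJ(\kappa,c)v_\eta$; $\widehat W_-(\eta;\kappa,c)=Uu(n_-,0,1)+W(\eta;\kappa,c)$. *)

(* Defs.v *)
(* U_q(sl_3) over C = R[i] (R : realType), presented as a
   quotient of the free associative C-algebra on the eight generators
   E1 E2 F1 F2 K1 K2 K1^-1 K2^-1 (multinomials' monoid algebra over the free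
   monoid {fmonom 'I_8}). *)
From mathcomp Require Import all_boot all_order all_algebra.
From mathcomp Require Import monalg complex reals.

Set Implicit Arguments.
Unset Strict Implicit.
Unset Printing Implicit Defensive.

Import Order.TTheory GRing.Theory Num.Theory.
Local Open Scope ring_scope.

Section Uqsl3.
Variable R : realType.
Local Notation C := (R[i]).

Definition FreeA := {malg C[{fmonom 'I_8}]}.

Definition gen (k : nat) : FreeA := << fmu (inord k : 'I_8) >>.

Definition E1 := gen 0.
Definition E2 := gen 1.
Definition F1 := gen 2.
Definition F2 := gen 3.
Definition K1 := gen 4.
Definition K2 := gen 5.
Definition K1i := gen 6.
Definition K2i := gen 7.

Variable q : C.

Definition jimbo_rels : seq FreeA :=
  [::
      K1 * K1i - 1; K1i * K1 - 1; K2 * K2i - 1; K2i * K2 - 1;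
      K1 * K2 - K2 * K1;
      (* K_i E_j K_i^{-1} = q^{a_ij} E_j *)
      K1 * E1 * K1i - (q ^+ 2) *: E1; K1 * E2 * K1i - q^-1 *: E2;
      K2 * E1 * K2i - q^-1 *: E1; K2 * E2 * K2i - (q ^+ 2) *: E2;
      (* K_i F_j K_i^{-1} = q^{-a_ij} F_j *)
      K1 * F1 * K1i - (q ^- 2) *: F1; K1 * F2 * K1i - q *: F2;
      K2 * F1 * K2i - q *: F1; K2 * F2 * K2i - (q ^- 2) *: F2;
      E1 * F1 - F1 * E1 - (q - q^-1)^-1 *: (K1 - K1i);
      E2 * F2 - F2 * E2 - (q - q^-1)^-1 *: (K2 - K2i);
      E1 * F2 - F2 * E1; E2 * F1 - F1 * E2;
      E1 * E1 * E2 - (q + q^-1) *: (E1 * E2 * E1) + E2 * E1 * E1;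
      E2 * E2 * E1 - (q + q^-1) *: (E2 * E1 * E2) + E1 * E2 * E2;
      F1 * F1 * F2 - (q + q^-1) *: (F1 * F2 * F1) + F2 * F1 * F1;
      F2 * F2 * F1 - (q + q^-1) *: (F2 * F1 * F2) + F1 * F2 * F2].

Definition jimbo_rel (x : FreeA) : Prop := x \in jimbo_rels.

Definition gen_ideal (S : FreeA -> Prop) (x : FreeA) : Prop :=
  forall P : FreeA -> Prop,
    (forall s, S s -> P s) -> P 0 ->
    (forall a b, P a -> P b -> P (a + b)) ->
    (forall r a, P a -> P (r * a)) ->
    (forall r a, P a -> P (a * r)) -> P x.

Definition gen_lideal (S : FreeA -> Prop) (x : FreeA) : Prop :=
  forall P : FreeA -> Prop,
    (forall s, S s -> P s) -> P 0 ->
    (forall a b, P a -> P b -> P (a + b)) ->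
    (forall r a, P a -> P (r * a)) -> P x.

Definition is_lideal (P : FreeA -> Prop) : Prop :=
  [/\ P 0, (forall a b, P a -> P b -> P (a + b)) &
      (forall r a, P a -> P (r * a))].

Definition gen_subalg (S : FreeA -> Prop) (x : FreeA) : Prop :=
  forall P : FreeA -> Prop,
    (forall s, S s -> P s) -> P 1 ->
    (forall c a, P a -> P (c *: a)) ->
    (forall a b, P a -> P b -> P (a + b)) ->
    (forall a b, P a -> P b -> P (a * b)) -> P x.

Variable alpha : C.

(* The left ideal  L = I + FreeA (E1 - alpha) + FreeA E2 ,  I the ideal of
   Jimbo relations.  M(eta) = U (x)_{U^+} C v_eta  =  FreeA / L, with
   v_eta the class of 1; U-submodules of M(eta) correspond exactly to the
   left ideals of FreeA containing L. *)
Definition Leta (x : FreeA) : Prop :=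
  gen_lideal (fun s => gen_ideal jimbo_rel s \/ s = E1 - alpha%:MP \/ s = E2) x.

Definition F3 : FreeA := F1 * F2 - q *: (F2 * F1).
Definition Kel : FreeA := K1 * K2 * K2.
Definition Kinv : FreeA := K2i * K2i * K1i.
Definition C1el : FreeA :=
  F1 * E1 + ((q - q^-1) ^+ 2)^-1 *: (q *: K1 + q^-1 *: K1i).

Definition qint (k : nat) : C := (q ^+ k - q ^- k) / (q - q^-1).
Definition qfact (k : nat) : C := \prod_(1 <= m < k.+1) qint m.
Definition qbinom (n k : nat) : C :=
  if (k <= n)%N then qfact n / (qfact k * qfact (n - k)) else 0.

(* The coefficients a_{kj}(n); the exponent k(2n+2j+k-7)/2 is an integer. *)
Definition acoef (n k j : nat) : C :=
  (-1) ^+ j * alpha ^+ k * (q ^+ 2 - 1) ^+ k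
  * q ^ ((j%:Z) * (n%:Z - 3))
  * q ^ (((k%:Z) * (2 * n%:Z + 2 * j%:Z + k%:Z - 7)) %/ 2)%Z
  * qbinom n k * qbinom (n - k) j.

Definition u_el (n : nat) : FreeA :=
  \sum_(0 <= k < n.+1) \sum_(0 <= j < (n - k).+1)
     acoef n k j *: (F2 ^+ (n - k) * F3 ^+ k * K2 ^+ (2 * j)
                     * Kinv ^+ (2 * j + k)).

Definition hval (n : nat) (kappa c : C) : C :=
  q ^ (3 - 2 * n%:Z) * kappa + q ^ (2 * n%:Z - 3) * kappa^-1
  - (q - q^-1) ^+ 2 * c.

Definition critical (kappa c : C) : Prop :=
  exists n : nat, (1 <= n)%N /\ hval n kappa c = 0.

(* lift of J(kappa,c) = C[K^{+-1},C1](K - kappa) + C[K^{+-1},C1](C1 - c) *)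
Definition Jset (kappa c : C) (x : FreeA) : Prop :=
  exists a b : FreeA,
    gen_subalg (fun s => [\/ s = Kel, s = Kinv | s = C1el]) a /\
    gen_subalg (fun s => [\/ s = Kel, s = Kinv | s = C1el]) b /\
    x = a * (Kel - kappa%:MP) + b * (C1el - c%:MP).

(* W(eta; kappa, c) = U J(kappa,c) v_eta, as a left ideal containing Leta *)
Definition Wset (kappa c : C) (x : FreeA) : Prop :=
  gen_lideal (fun s => Leta s \/ Jset kappa c s) x.

(* hat W_-(eta; kappa, c) = U u(n_-,0,1) + W(eta;kappa,c), with n = n_- *)
Definition Whatset (kappa c : C) (n : nat) (x : FreeA) : Prop :=
  gen_lideal (fun s => Wset kappa c s \/ s = u_el n) x.

Definition maximal_submodule (N : FreeA -> Prop) : Prop :=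
  [/\ is_lideal N, (forall x, Leta x -> N x), ~ (forall x, N x) &
      forall N' : FreeA -> Prop, is_lideal N' -> (forall x, N x -> N' x) ->
        (forall x, N' x <-> N x) \/ (forall x, N' x)].

End Uqsl3.

(* Main.v *)
From HB Require Import structures.
Require Import Defs.
From mathcomp Require Import all_boot all_order all_algebra.
From mathcomp Require finmap.
From mathcomp Require Import ring zify generic_quotient ring_quotient.
From mathcomp Require Import monalg complex boolp classical_sets reals.
Set Implicit Arguments.
Unset Strict Implicit.
Unset Printing Implicit Defensive.
Import Order.TTheory GRing.Theory Num.Theory.
Local Open Scope ring_scope.

(* Let L = M(eta)/N be the simple quotient and v the image of v_eta.  U has two
   elements y1, y2 that q-commute with all the generators and act on vectors x
   with E1 x = alpha x, E2 x = 0 as (q - q^-1)^2 C1 + q^-3 K^-1 and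
   (q - q^-1)^2 C1 + q^3 K.  Hence y1^3 K, y1 y2 and y2^3 K^-1 are central; they
   act by scalars on L, because L has countable dimension and the complex field
   is uncountable (Dixmier).  This gives a polynomial in K that kills v, hence a
   common eigenvector w of K and C1 with E1 w = alpha w, E2 w = 0.  Comparing
   K-weights, v is proportional to w, so N contains some W(kappa, c).
   In M(eta)/W(kappa, c) one has u(n, 0, 1) = G^n v for a single element G of U,
   E2 u(n) is a nonzero multiple of h_n K2 u(n - 1), and the K2^l F2^a u(b) span.
   Since E1 E2 - q E2 E1 kills u(n) and acts on F2^a u(b) as a lowering operator
   for a, every submodule is spanned by the K2^l F2^a u(b) with u(b) in the
   submodule, and then the zeros of h_n decide which u(b) may occur.  Only
   spanning is used, never the linear independence of a PBW basis. *)

(** * Deciding identities between linear combinations *)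

(* The tactic lmod turns an equality of linear combinations into the equalities
   of the coefficients of each atom, which ring or field can then prove. *)

(** Neither K nor C1 is central, so Schur's lemma does not apply to them. But on vectors x with E1 x
    = alpha x and E2 x = 0 one has y2 - y1 = q^3 K - q^-3 K^-1, and the three central scalars
    combine into a cubic relation for K alone. Maximality of N is used only through the simplicity
    of L, which gives a rigidity: all nonzero x in L with E1 x = alpha x, E2 x = 0 that are
    eigenvectors of K and C1 have the same K-eigenvalue. Indeed any of them generates L, so that the
    K-eigenvalues of L are q^(-3n) times its own with n >= 0, and this holds in both directions. The
    rigidity serves twice: it makes v a multiple of w, and it puts u(n) in N whenever n >= 1 and h_n
    = 0, since E2 then kills u(n) while its K-eigenvalue q^(-3n) kappa differs from kappa. The other
    inclusion is a descent in M(eta)/W(kappa, c): if u(b) is in N, applying E2 leads down inside N,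
    and since v is not in N this stops at some n with 1 <= n <= b and h_n = 0. Thus N contains only
    u(b) with b >= n_-, and these are G^(b - n_-) u(n_-). *)

Inductive lexpr (F : Type) :=
  | LAtom of nat | LZero | LAdd of lexpr F & lexpr F
  | LOpp of lexpr F | LScale of F & lexpr F.
Arguments LAtom {F}. Arguments LZero {F}.

Section LinearCombination.
Variables (F : nzRingType) (V : lmodType F).

Fixpoint leval (env : seq V) (e : lexpr F) : V :=
  match e with
  | LAtom n => nth 0 env n
  | LZero => 0
  | LAdd a b => leval env a + leval env b
  | LOpp a => - leval env a
  | LScale c a => c *: leval env a
  end.

(** [Nat.eqb] on literal indices reduces under [cbn], which leaves coefficients built from ring
    operations only. *)
Fixpoint lcoef (e : lexpr F) (i : nat) : F :=
  match e with
  | LAtom n => if Nat.eqb n i then 1 else 0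
  | LZero => 0
  | LAdd a b => lcoef a i + lcoef b i
  | LOpp a => - lcoef a i
  | LScale c a => c * lcoef a i
  end.

Lemma levalE env e :
  leval env e = \sum_(i < size env) lcoef e i *: env`_i.
Proof.
elim: e => [n||a IHa b IHb|a IHa|c a IHa] /=.
- have [ltn|gen] := ltnP n (size env); last first.
    rewrite nth_default // big1 // => i _.
    case: PeanoNat.Nat.eqb_spec => [eni|_]; last by rewrite scale0r.
    by have := ltn_ord i; rewrite -eni ltnNge gen.
  rewrite (bigD1 (Ordinal ltn)) //= PeanoNat.Nat.eqb_refl scale1r big1 ?addr0 //.
  move=> i; case: PeanoNat.Nat.eqb_spec => [eni|_]; last by rewrite scale0r.
  by rewrite -val_eqE /= eni eqxx.
- by rewrite big1 // => i _; rewrite scale0r.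
- by rewrite IHa IHb -big_split; apply: eq_bigr => i _; rewrite scalerDl.
- by rewrite IHa -sumrN; apply: eq_bigr => i _; rewrite scaleNr.
- by rewrite IHa scaler_sumr; apply: eq_bigr => i _; rewrite scalerA.
Qed.

(** A right-nested conjunction with one equation per atom, which [repeat split] breaks into goals
    for [ring] or [field]. *)
Fixpoint lcoefs_eq (a b : lexpr F) (n : nat) : Prop :=
  if n is m.+1 then lcoef a m = lcoef b m /\ lcoefs_eq a b m else True.

Lemma leval_eq env a b : lcoefs_eq a b (size env) -> leval env a = leval env b.
Proof.
move=> ab; rewrite !levalE; apply: eq_bigr => i _; congr (_ *: _).
elim: (size env) ab i => [_ []//|n IHn [abn abs] i].
have [->//|/negPf in'] := eqVneq (val i) n.
have lin : (i < n)%N by have := ltn_ord i; rewrite ltnS leq_eqVlt in'.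
exact: (IHn abs (Ordinal lin)).
Qed.

End LinearCombination.

Ltac latom_index x env :=
  match env with
  | x :: _ => constr:(O)
  | _ :: ?env' => let n := latom_index x env' in constr:(S n)
  end.
Ltac latom_add x env :=
  match env with
  | _ => let _ := latom_index x env in env
  | _ => constr:(x :: env)
  end.
Ltac latoms e env :=
  lazymatch e with
  | GRing.add ?a ?b => let env := latoms a env in latoms b env
  | GRing.opp ?a => latoms a env
  | GRing.scale _ ?a => latoms a env
  | GRing.zero => env
  | _ => latom_add e env
  end.
Ltac lreify F e env :=
  lazymatch e with
  | GRing.add ?a ?b =>
      let a := lreify F a env in let b := lreify F b env in constr:(@LAdd F a b)
  | GRing.opp ?a => let a := lreify F a env in constr:(@LOpp F a)
  | GRing.scale ?c ?a => let a := lreify F a env in constr:(@LScale F c a)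
  | GRing.zero => constr:(@LZero F)
  | _ => let n := latom_index e env in constr:(@LAtom F n)
  end.
Ltac lmod F :=
  lazymatch goal with
  | |- @eq ?V ?a ?b =>
    let env := latoms a (@nil V) in
    let env := latoms b env in
    let ea := lreify F a env in
    let eb := lreify F b env in
    refine (@leval_eq _ _ env ea eb _); 
    cbn -[GRing.add GRing.mul GRing.opp GRing.one GRing.zero GRing.inv GRing.exp]
  end.

(** * Operators on a vector space *)

Section Subspace.
Variables (F : fieldType) (V : lmodType F).

Record subspace (S : V -> Prop) : Prop := Subspace {
  sub0 : S 0;
  subD : forall x y, S x -> S y -> S (x + y);
  subZ : forall c x, S x -> S (c *: x) }.

Lemma subN S x : subspace S -> S x -> S (- x).
Proof. by move=> sS Sx; rewrite -scaleN1r; apply: subZ. Qed.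

Lemma subB S x y : subspace S -> S x -> S y -> S (x - y).
Proof. by move=> sS Sx Sy; apply: (subD sS) => //; apply: subN. Qed.

Lemma subZr S c x : subspace S -> c != 0 -> S (c *: x) -> S x.
Proof.
by move=> sS c0 /(subZ sS c^-1); rewrite scalerA mulVf // scale1r.
Qed.

Lemma sub_sum S (I : Type) (r : seq I) (P : pred I) (y : I -> V) :
  subspace S -> (forall i, P i -> S (y i)) -> S (\sum_(i <- r | P i) y i).
Proof. by move=> sS Sy; apply: big_ind; [exact: sub0|exact: subD|]. Qed.

Inductive span (A : V -> Prop) : V -> Prop :=
  | span0 : span A 0
  | span_gen x : A x -> span A x
  | spanD x y : span A x -> span A y -> span A (x + y)
  | spanZ c x : span A x -> span A (c *: x).

Lemma span_subspace A : subspace (span A).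
Proof. by split; [exact: span0|exact: spanD|exact: spanZ]. Qed.

Lemma span_min (A S : V -> Prop) : subspace S -> (forall x, A x -> S x) ->
  forall x, span A x -> S x.
Proof.
move=> sS AS x; elim=> {x} [|x /AS //|x y _ + _|c x _].
- exact: sub0.
- exact: subD.
- exact: subZ.
Qed.

Lemma preim_subspace (g : {linear V -> V}) S :
  subspace S -> subspace (fun x => S (g x)).
Proof.
move=> sS; split=> [|x y Sx Sy|c x Sx]; first by rewrite linear0; apply: sub0.
  by rewrite linearD; apply: subD.
by rewrite linearZ; apply: subZ.
Qed.

(** Terms with the same index are merged, so that [s] has no repetition: this is the form in which
    [eig_component] can separate the summands. *)
Lemma span_decomp (T : eqType) (P : T -> V -> Prop) A x :
  (forall t, subspace (P t)) -> (forall x, A x -> exists t, P t x) ->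
  span A x -> exists (s : seq T) (y : T -> V),
    [/\ uniq s, forall t, P t (y t) & x = \sum_(t <- s) y t].
Proof.
move=> sP AP; elim=> {x} [|x /AP[t Ptx]|x y _ [s [y1 [us Py1 ->]]]
  _ [s' [y2 [us' Py2 ->]]]|c x _ [s [y [us Py ->]]]].
- exists [::], (fun=> 0); split=> //; last by rewrite big_nil.
  by move=> t; apply: sub0.
- exists [:: t], (fun t' => if t' == t then x else 0).
  split=> //; last by rewrite big_seq1 eqxx.
  by move=> t'; case: eqP => [->//|_]; apply: sub0.
- exists (undup (s ++ s')).
  exists (fun t => (if t \in s then y1 t else 0) + (if t \in s' then y2 t else 0)).
  split=> [|t|]; first exact: undup_uniq.
    by apply: subD => //; case: ifP => _ //; apply: sub0.
  have ext r z : uniq r -> {subset r <= undup (s ++ s')} ->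
      \sum_(t <- r) z t =
      \sum_(t <- undup (s ++ s')) (if t \in r then z t else 0) :> V.
    move=> ur sr; rewrite -big_mkcond /= -[RHS]big_filter; apply: perm_big.
    rewrite uniq_perm ?filter_uniq ?undup_uniq // => t.
    by rewrite mem_filter; case rt : (t \in r); rewrite //= sr.
  by rewrite big_split /= -!ext // => t ts; rewrite mem_undup mem_cat ts ?orbT.
- exists s, (fun t => c *: y t); split=> // [t|]; first exact: subZ.
  by rewrite scaler_sumr.
Qed.

(* All the summands but one are killed by a product of operators g - lam t1. *)
Lemma eig_component (T : eqType) (P : T -> V -> Prop) (S : V -> Prop) s y :
  subspace S -> (forall t, subspace (P t)) ->
  (forall t t', t != t' -> exists (g : {linear V -> V}) (lam : T -> F),
    [/\ forall x, S x -> S (g x), forall t'' x, P t'' x -> g x = lam t'' *: x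
      & lam t != lam t']) ->
  uniq s -> (forall t, P t (y t)) -> S (\sum_(t <- s) y t) ->
  forall t, t \in s -> S (y t).
Proof.
move=> sS sP sep us Py Sy t ts.
have {}Sy : S (y t + \sum_(t' <- rem t s) y t').
  by move: Sy; rewrite (big_rem t).
move: Sy; have : t \notin rem t s by rewrite mem_rem_uniq // inE eqxx.
elim: (rem t s) y Py => [|t1 r IHr] y Py /=; first by rewrite big_nil addr0.
rewrite inE negb_or => /andP[tt1 tr]; rewrite big_cons => Sx.
have [g [lam [Sg gP lam1]]] := sep _ _ tt1.
apply: (@subZr S (lam t - lam t1)); rewrite ?subr_eq0 //.
apply: (IHr (fun t' => (lam t' - lam t1) *: y t')) => // [t'|].
  exact: subZ.
have -> : (lam t - lam t1) *: y t + \sum_(t' <- r) (lam t' - lam t1) *: y t' =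
    g (y t + (y t1 + \sum_(t' <- r) y t')) -
    lam t1 *: (y t + (y t1 + \sum_(t' <- r) y t')).
  rewrite !(linearD g) /= linear_sum !(gP _ _ (Py _)) scalerDr opprD addrACA.
  rewrite -scalerBl; congr (_ + _).
  rewrite scalerDr opprD addrACA subrr add0r.
  rewrite scaler_sumr -sumrB.
  by apply: eq_bigr => t' _; rewrite (gP _ _ (Py _)) scalerBl.
by apply: subB => //; [exact: Sg|exact: subZ].
Qed.

End Subspace.

Section OperatorPolynomial.
Variables (F : fieldType) (V : lmodType F) (z : {linear V -> V}).
Implicit Types (p : {poly F}) (x : V).

Definition pev p x := \sum_(i < size p) p`_i *: iter i z x.

Lemma pev_widen n p x : (size p <= n)%N ->
  pev p x = \sum_(i < n) p`_i *: iter i z x.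
Proof.
move=> pn; rewrite /pev (big_ord_widen n (fun i => p`_i *: iter i z x)) //.
rewrite big_mkcond; apply: eq_bigr => i _; case: ltnP => // pi.
by rewrite nth_default // scale0r.
Qed.

Lemma pevD p1 p2 x : pev (p1 + p2) x = pev p1 x + pev p2 x.
Proof.
set n := maxn (size p1) (size p2).
rewrite (@pev_widen n) ?size_polyD // (@pev_widen n p1) ?leq_maxl //.
rewrite (@pev_widen n p2) ?leq_maxr // -big_split.
by apply: eq_bigr => i _; rewrite coefD scalerDl.
Qed.

Lemma pevZ c p x : pev (c *: p) x = c *: pev p x.
Proof.
rewrite (@pev_widen (size p)) ?size_scale_leq // scaler_sumr.
by apply: eq_bigr => i _; rewrite coefZ scalerA.
Qed.

Lemma pevC c x : pev c%:P x = c *: x.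
Proof. by rewrite (@pev_widen 1) ?size_polyC_leq1 // big_ord1 coefC. Qed.

Lemma pev_sum (I : Type) (r : seq I) (P : pred I) (p : I -> {poly F}) x :
  pev (\sum_(i <- r | P i) p i) x = \sum_(i <- r | P i) pev (p i) x.
Proof.
apply: (big_morph (pev^~ x)) => [p1 p2|]; first exact: pevD.
by rewrite -[0]/(0%:P) pevC scale0r.
Qed.

Lemma pevMX p x : pev (p * 'X) x = z (pev p x).
Proof.
rewrite (@pev_widen (size p).+1); last first.
  by rewrite (leq_trans (size_polyMleq _ _)) // size_polyX addn2.
rewrite big_ord_recl coefMX scale0r add0r linear_sum.
by apply: eq_bigr => i _; rewrite coefMX linearZ.
Qed.

Lemma pev_linear p : linear (pev p).
Proof.
elim/poly_ind: p => [|p c IHp] a x y.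
  by rewrite -[0]/(0%:P) !pevC !scale0r scaler0 addr0.
rewrite !pevD !pevMX !pevC IHp linearP !scalerDr !addrA; congr (_ + _).
by rewrite !scalerA mulrC addrAC.
Qed.

HB.instance Definition _ p :=
  GRing.isLinear.Build F V V *:%R (pev p) (pev_linear p).

Lemma pevM p1 p2 x : pev (p1 * p2) x = pev p1 (pev p2 x).
Proof.
elim/poly_ind: p1 => [|p1 c IHp].
  by rewrite mul0r -[0]/(0%:P) !pevC !scale0r.
rewrite mulrDl !pevD !pevMX pevC -IHp -mulrA ['X * _]mulrC mulrA pevMX.
by rewrite mul_polyC pevZ.
Qed.

Lemma pevXn n x : pev 'X^n x = iter n z x.
Proof.
by elim: n => [|n IHn]; rewrite ?expr0 ?pevC ?scale1r // exprSr pevMX IHn.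
Qed.

Lemma pevXsubC r x : pev ('X - r%:P) x = z x - r *: x.
Proof.
by rewrite -polyCN pevD pevC -['X]mul1r pevMX pevC scale1r scaleNr.
Qed.

End OperatorPolynomial.

Section Eigenvector.
Variables (F : closedFieldType) (V : lmodType F) (z : {linear V -> V}).

(** [p] splits into linear factors. Applied to [x] one at a time they reach 0, and the last nonzero
    vector is an eigenvector; being obtained from [x] by means of [z], it stays in [S]. *)
Lemma eigenvector_exists (S : V -> Prop) p x :
  subspace S -> (forall y, S y -> S (z y)) ->
  S x -> x != 0 -> p != 0 -> pev z p x = 0 ->
  exists y r, [/\ S y, y != 0 & z y = r *: y].
Proof.
move=> sS Sz Sx x0 p0; have [r ->] := closed_field_poly_normal p.
rewrite pevZ => /eqP; rewrite scaler_eq0 lead_coef_eq0 (negPf p0) /= => /eqP.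
elim: r x Sx x0 => [|a r IHr] x Sx x0.
  by rewrite big_nil pevC scale1r => /eqP; rewrite (negPf x0).
rewrite big_cons mulrC pevM pevXsubC.
have [zx|zx] := eqVneq (z x - a *: x) 0; last first.
  by apply: IHr => //; apply: subB => //; [apply: Sz|apply: subZ].
by move=> _; exists x, a; split=> //; apply/eqP; rewrite -subr_eq0 zx.
Qed.

End Eigenvector.

(** * Schur's lemma in Dixmier's form, over an uncountable field *)

Lemma lin_dep (F : fieldType) (V : lmodType F) m n (b : 'I_m -> V)
    (x : 'I_n -> V) (A : 'M[F]_(n, m)) :
  (m < n)%N -> (forall i, x i = \sum_j A i j *: b j) ->
  exists2 c : 'rV[F]_n, c != 0 & \sum_i c 0 i *: x i = 0.
Proof.
move=> mn xE; have /rowV0Pn[c /sub_kermxP cA c0] : kermx A != 0.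
  by rewrite kermx_eq0 -row_leq_rank -ltnNge (leq_ltn_trans (rank_leq_col A)).
exists c => //; under eq_bigr => i _ do rewrite xE scaler_sumr.
rewrite exchange_big big1 //= => j _.
under eq_bigr => i _ do rewrite scalerA.
rewrite -scaler_suml; move/rowP: cA => /(_ j); rewrite !mxE => ->.
by rewrite scale0r.
Qed.

(** A pigeonhole form of uncountability: a cover by countably many sets has an infinite member,
    infinite meaning not contained in any finite list. *)
Definition uncountable (T : eqType) := forall A : nat -> T -> Prop,
  (forall c, exists n, A n c) ->
  exists n, forall s : seq T, exists2 c, c \notin s & A n c.

Lemma uniq_seq_of_infinite (T : eqType) (A : T -> Prop) n :
  (forall s : seq T, exists2 c, c \notin s & A c) ->
  exists s : n.-tuple T, uniq s /\ forall i, A (tnth s i).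
Proof.
move=> Ainf; elim: n => [|n [s [us As]]].
  by exists [tuple]; split=> // -[].
have [c cs Ac] := Ainf s; exists [tuple of c :: s]; split=> /=.
  by rewrite cs.
by move=> i; case: (unliftP 0 i) => [j ->|->] //; rewrite tnthS.
Qed.

Section Dixmier.
Variables (F : closedFieldType) (V : lmodType F).
Hypothesis Func : uncountable F.
Variable B : nat -> seq V.
Hypothesis Bspan : forall x, exists n, span (fun y => y \in B n) x.

Lemma span_seq (b : seq V) x : span (fun y => y \in b) x ->
  exists c : 'I_(size b) -> F, x = \sum_i c i *: b`_i.
Proof.
elim=> {x} [|x xb|x y _ [c ->] _ [d ->]|a x _ [c ->]].
- by exists (fun=> 0); rewrite big1 // => i _; rewrite scale0r.
- have ib : (index x b < size b)%N by rewrite index_mem.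
  exists (fun i => (i == Ordinal ib)%:R).
  rewrite (bigD1 (Ordinal ib)) //= eqxx scale1r nth_index // big1 ?addr0 //.
  by move=> i /negPf ->; rewrite scale0r.
- exists (fun i => c i + d i); rewrite -big_split.
  by apply: eq_bigr => i _; rewrite scalerDl.
- exists (fun i => a * c i); rewrite scaler_sumr.
  by apply: eq_bigr => i _; rewrite scalerA.
Qed.

(* Amitsur's trick: the resolvents (z - c)^-1 v, for uncountably many c, are
   linearly dependent, and clearing denominators in a linear relation between
   them gives a polynomial in z that kills v. *)
Lemma resolvent_eigenvector (z : {linear V -> V}) v : v != 0 ->
  (forall c, exists x, z x - c *: x = v) ->
  exists y r, y != 0 /\ z y = r *: y.
Proof.
move=> v0 res.
(* Each [c] is filed under an [n] such that a preimage of [v] under z - c lies in the span of [B n].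
   One [n] receives infinitely many [c], hence more than [size (B n)] of them. *)
have [c|n An] := Func (A := fun n c => exists2 x, span (fun y => y \in B n) x &
    z x - c *: x = v).
  by have [x xv] := res c; have [n nx] := Bspan x; exists n, x.
have [l [ul Al]] := uniq_seq_of_infinite (size (B n)).+1 An.
have /fin_all_exists[x xP] : forall i, exists x, span (fun y => y \in B n) x /\
    z x - tnth l i *: x = v.
  by move=> i; have [x] := Al i; exists x.
have /fin_all_exists[c cP] : forall i, exists c : 'I_(size (B n)) -> F,
    x i = \sum_j c j *: (B n)`_j.
  by move=> i; apply: span_seq; case: (xP i).
have [||d d0 dx] := @lin_dep _ _ _ _ (fun j : 'I_(size (B n)) => (B n)`_j) x
  (\matrix_(i, j) c i j); first exact: ltnSn.
  by move=> i; rewrite cP; apply: eq_bigr => j _; rewrite mxE.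
(* [p] is the numerator of the sum of the d_i / (z - l_i). At l_i every [w j] with j != i vanishes
   and [w i] does not, so [p] is nonzero as soon as some d_i is. *)
pose w i : {poly F} := \prod_(j | j != i) ('X - (tnth l j)%:P).
pose p := \sum_i d 0 i *: w i.
have [i di] : exists i, d 0 i != 0.
  apply/existsP; apply: contraR d0; rewrite negb_exists => /forallP d0.
  by apply/eqP/rowP => i; rewrite mxE; apply/eqP; rewrite -[_ == _]negbK.
have p0 : p != 0.
  apply: contraNneq di => p0; have: p.[tnth l i] = 0 by rewrite p0 horner0.
  rewrite horner_sum (bigD1 i) //= big1 ?addr0 => [|j ji]; last first.
    rewrite hornerZ horner_prod (bigD1 i) 1?eq_sym //=.
    by rewrite hornerXsubC subrr mul0r mulr0.
  move/eqP; rewrite hornerZ mulf_eq0 => /orP[//|].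
  rewrite horner_prod prodf_seq_eq0 => /hasP[j _ /andP[ji]].
  rewrite hornerXsubC subr_eq0 => /eqP /(tuple_uniqP _ ul) ij.
  by rewrite ij eqxx in ji.
have pv : pev z p v = 0.
  rewrite /p pev_sum; pose W : {poly F} := \prod_j ('X - (tnth l j)%:P).
  have -> : \sum_j pev z (d 0 j *: w j) v = \sum_j d 0 j *: pev z W (x j).
    apply: eq_bigr => j _; rewrite pevZ -{1}(xP j).2 -pevXsubC -pevM.
    by rewrite /W (bigD1 j) //= mulrC.
  transitivity (pev z W (\sum_j d 0 j *: x j)); last by rewrite dx linear0.
  by rewrite linear_sum; apply: eq_bigr => j _; rewrite linearZ.
have [y [r [_ y0 zy]]] := @eigenvector_exists F V z (fun=> True) p v
  (Subspace I (fun _ _ _ _ => I) (fun _ _ _ => I)) (fun _ _ => I) I v0 p0 pv.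
by exists y, r.
Qed.

End Dixmier.

(** * Uncountability of the real and complex numbers *)

Section Uncountable.
Variable R : realType.

(** A point [x] is avoided by the right half of the interval or by its left quarter, according to
    the side on which it lies. *)
Lemma itv_avoid (s : seq R) (a b : R) : a < b ->
  exists a' b', [/\ a <= a', a' < b', b' <= b &
    forall c, a' <= c <= b' -> c \notin s].
Proof.
elim: s a b => [|x s IHs] a b ab; first by exists a, b.
pose m := (a + b) / 2%:R.
have [am mb] : a < m /\ m < b by rewrite !midf_lt.
have [[a1 b1] [ab1 [aa1 bb1 xn]]] : exists p : R * R, p.1 < p.2 /\
    [/\ a <= p.1, p.2 <= b & forall c, p.1 <= c <= p.2 -> c != x].
  have [xm|mx] := leP x ((a + m) / 2%:R).
    exists (m, b); split=> //; split=> //=; first exact: ltW.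
    move=> c /andP[mc _]; apply: contraTneq mc => ->; rewrite -ltNge.
    by apply: le_lt_trans xm _; apply: (midf_lt am).2.
  exists (a, (a + m) / 2%:R); have [a1 a2] := midf_lt am.
  split=> //; split=> //=; first by rewrite ltW // (lt_trans a2).
  move=> c /andP[_ cm]; apply: contraTneq cm => ->; by rewrite -ltNge.
have [a' [b' [aa' ab' bb' sn]]] := IHs _ _ ab1.
exists a', b'; split=> //; [exact: le_trans aa1 aa'|exact: le_trans bb' bb1|].
move=> c /andP[ac cb]; rewrite inE negb_or sn ?ac // andbT; apply: xn => /=.
by rewrite (le_trans aa') // (le_trans cb).
Qed.

(** Cantor's nested intervals: if each [A n] were contained in a finite list [s n], the next
    interval could be chosen inside the previous one and disjoint from [s n]; the supremum of the
    left endpoints lies in all intervals, hence in no [A n]. *)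
Lemma uncountable_real : uncountable R.
Proof.
move=> A AR; apply: contrapT => /forallNP noA.
have /choice[s sA] : forall n, exists s : seq R, forall c, A n c -> c \in s.
  move=> n; have /existsNP[s sn] := noA n.
  exists s => c Ac; apply: contraPT sn => cs; rewrite not_notE.
  by exists c.
pose step (n : nat) (p : R * R) (p' : R * R) := p.1 < p.2 ->
  [/\ p.1 <= p'.1, p'.1 < p'.2, p'.2 <= p.2 &
    forall c, p'.1 <= c <= p'.2 -> c \notin s n].
have /choice[f fP] : forall np : nat * (R * R), exists p', step np.1 np.2 p'.
  move=> [n [a b]] /=; have [ab|ab] := boolP (a < b); last first.
    by exists (a, b) => /=; rewrite /step /= (negPf ab).
  by have [a' [b' H]] := itv_avoid (s n) ab; exists (a', b').
pose I := fix I n := if n is m.+1 then f (m, I m) else (0, 1) : R * R.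
have Ilt n : (I n).1 < (I n).2.
  by elim: n => [|n IHn] /=; [exact: ltr01|case: (fP (n, I n) IHn)].
have Istep n := fP (n, I n) (Ilt n).
have mono m n : (m <= n)%N -> (I m).1 <= (I n).1 /\ (I n).2 <= (I m).2.
  move=> /subnK <-; elim: (n - m)%N => [//|k [IH1 IH2]]; rewrite addSn /=.
  have [h1 _ h2 _] := Istep (k + m)%N.
  by split; [exact: le_trans h1|exact: le_trans IH2].
pose E : set R := fun x => exists n, x = (I n).1.
have Eub n : ubound E (I n).2.
  move=> _ [m ->]; have [mn|nm] := leqP m n.
    by rewrite (le_trans (mono _ _ mn).1) // ltW.
  by rewrite (le_trans (ltW (Ilt m))) // (mono _ _ (ltnW nm)).2.
have supE : has_sup E by split; [exists (I 0%N).1, 0%N|exists (I 0%N).2].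
have [n An] := AR (sup E); have := sA _ _ An; apply/negP.
have [_ _ _ avoid] := Istep n; apply: avoid; apply/andP; split.
  by apply: sup_upper_bound => //; exists n.+1.
by apply: ge_sup => //; [exists (I 0%N).1, 0%N|exact: (Eub n.+1)].
Qed.

Lemma uncountable_complex : uncountable R[i].
Proof.
move=> A AC; have [c|n nA] := uncountable_real (A := fun n c => A n c%:C%C).
  exact: AC.
exists n => s; have [c cs Ac] := nA (map (@complex.Re R) s).
by exists c%:C%C => //; apply: contra cs => /(map_f (@complex.Re R)).
Qed.
End Uncountable.

(** * Modules over the quantum group *)

(** The relations are oriented as rewriting rules towards the order F, E, K: [k] moves inwards, [e]
    passes to the right of [f], and the Serre relations are solved for e1 e1 e2, e1 e2 e2 and the
    same words in f. *)
Record uq_module (F : fieldType) (q : F) (V : lmodType F) := UqModule {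
  e1 : {linear V -> V}; e2 : {linear V -> V};
  f1 : {linear V -> V}; f2 : {linear V -> V};
  k1 : {linear V -> V}; k2 : {linear V -> V};
  k1i : {linear V -> V}; k2i : {linear V -> V};
  k1K : cancel k1 k1i; k1iK : cancel k1i k1;
  k2K : cancel k2 k2i; k2iK : cancel k2i k2;
  k2k1 : forall x, k2 (k1 x) = k1 (k2 x);
  k1e1 : forall x, k1 (e1 x) = q ^+ 2 *: e1 (k1 x);
  k1e2 : forall x, k1 (e2 x) = q^-1 *: e2 (k1 x);
  k2e1 : forall x, k2 (e1 x) = q^-1 *: e1 (k2 x);
  k2e2 : forall x, k2 (e2 x) = q ^+ 2 *: e2 (k2 x);
  k1f1 : forall x, k1 (f1 x) = q ^- 2 *: f1 (k1 x);
  k1f2 : forall x, k1 (f2 x) = q *: f2 (k1 x);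
  k2f1 : forall x, k2 (f1 x) = q *: f1 (k2 x);
  k2f2 : forall x, k2 (f2 x) = q ^- 2 *: f2 (k2 x);
  e1f1 : forall x, e1 (f1 x) = f1 (e1 x) + (q - q^-1)^-1 *: (k1 x - k1i x);
  e2f2 : forall x, e2 (f2 x) = f2 (e2 x) + (q - q^-1)^-1 *: (k2 x - k2i x);
  e1f2 : forall x, e1 (f2 x) = f2 (e1 x);
  e2f1 : forall x, e2 (f1 x) = f1 (e2 x);
  e112 : forall x,
    e1 (e1 (e2 x)) = (q + q^-1) *: e1 (e2 (e1 x)) - e2 (e1 (e1 x));
  e122 : forall x,
    e1 (e2 (e2 x)) = (q + q^-1) *: e2 (e1 (e2 x)) - e2 (e2 (e1 x));
  f112 : forall x,
    f1 (f1 (f2 x)) = (q + q^-1) *: f1 (f2 (f1 x)) - f2 (f1 (f1 x));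
  f122 : forall x,
    f1 (f2 (f2 x)) = (q + q^-1) *: f2 (f1 (f2 x)) - f2 (f2 (f1 x))
}.

Section UqModule.
Variables (F : fieldType) (q : F) (V : lmodType F) (M : uq_module q V).
Hypothesis q0 : q != 0.
Local Notation e1 := (e1 M). Local Notation e2 := (e2 M).
Local Notation f1 := (f1 M). Local Notation f2 := (f2 M).
Local Notation k1 := (k1 M). Local Notation k2 := (k2 M).
Local Notation k1i := (k1i M). Local Notation k2i := (k2i M).

Lemma conj_inv (k ki g : {linear V -> V}) (c : F) : c != 0 ->
  cancel k ki -> cancel ki k -> (forall x, k (g x) = c *: g (k x)) ->
  forall x, ki (g x) = c^-1 *: g (ki x).
Proof.
move=> c0 kK kiK kg x; apply: (can_inj kK).
by rewrite kiK linearZ /= kg scalerA mulVf // scale1r kiK.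
Qed.

Let qV0 : q^-1 != 0. Proof. by rewrite invr_eq0. Qed.
Let qX0 n : q ^+ n != 0. Proof. exact: expf_neq0. Qed.
Let qXV0 n : q ^- n != 0. Proof. by rewrite invr_eq0. Qed.

Lemma k1ie1 x : k1i (e1 x) = q ^- 2 *: e1 (k1i x).
Proof. exact: (conj_inv (qX0 2) (k1K M) (k1iK M) (k1e1 M)). Qed.
Lemma k1ie2 x : k1i (e2 x) = q *: e2 (k1i x).
Proof. by rewrite (conj_inv qV0 (k1K M) (k1iK M) (k1e2 M)) invrK. Qed.
Lemma k2ie1 x : k2i (e1 x) = q *: e1 (k2i x).
Proof. by rewrite (conj_inv qV0 (k2K M) (k2iK M) (k2e1 M)) invrK. Qed.
Lemma k2ie2 x : k2i (e2 x) = q ^- 2 *: e2 (k2i x).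
Proof. exact: (conj_inv (qX0 2) (k2K M) (k2iK M) (k2e2 M)). Qed.
Lemma k1if1 x : k1i (f1 x) = q ^+ 2 *: f1 (k1i x).
Proof. by rewrite (conj_inv (qXV0 2) (k1K M) (k1iK M) (k1f1 M)) invrK. Qed.
Lemma k1if2 x : k1i (f2 x) = q^-1 *: f2 (k1i x).
Proof. exact: (conj_inv q0 (k1K M) (k1iK M) (k1f2 M)). Qed.
Lemma k2if1 x : k2i (f1 x) = q^-1 *: f1 (k2i x).
Proof. exact: (conj_inv q0 (k2K M) (k2iK M) (k2f1 M)). Qed.
Lemma k2if2 x : k2i (f2 x) = q ^+ 2 *: f2 (k2i x).
Proof. by rewrite (conj_inv (qXV0 2) (k2K M) (k2iK M) (k2f2 M)) invrK. Qed.
Lemma k2k1i x : k2 (k1i x) = k1i (k2 x).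
Proof. by apply: (can_inj (k1K M)); rewrite -k2k1 !k1iK. Qed.
Lemma k2ik1 x : k2i (k1 x) = k1 (k2i x).
Proof. by apply: (can_inj (k2K M)); rewrite k2k1 !k2iK. Qed.
Lemma k2ik1i x : k2i (k1i x) = k1i (k2i x).
Proof. by apply: (can_inj (k2K M)); rewrite k2k1i !k2iK. Qed.

Definition uqE := (k1K M, k1iK M, k2K M, k2iK M, k2k1 M, k2k1i, k2ik1, k2ik1i,
  k1e1 M, k1e2 M, k2e1 M, k2e2 M, k1f1 M, k1f2 M, k2f1 M, k2f2 M,
  k1ie1, k1ie2, k2ie1, k2ie2, k1if1, k1if2, k2if1, k2if2).
Definition uqF := (e1f1 M, e2f2 M, e1f2 M, e2f1 M).
Definition uqS := (e112 M, e122 M, f112 M, f122 M).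

Lemma lin_pushE (g : {linear V -> V}) :
  ((forall x y, g (x + y)%R = (g x + g y)%R) * (forall x, g (- x)%R = (- g x)%R)
   * (forall c x, g (c *: x) = c *: g x))%type.
Proof. by do !split=> *; rewrite ?linearD ?linearN ?linearZ. Qed.

Definition uqL := (lin_pushE e1, lin_pushE e2, lin_pushE f1, lin_pushE f2,
  lin_pushE k1, lin_pushE k2, lin_pushE k1i, lin_pushE k2i).


End UqModule.

(** K is moved first, then E past F, which creates new factors K to be moved; the Serre relations
    come last. *)
Ltac uq_nf M q0 :=
  repeat progress rewrite ?(uqE M q0) ?(uqL M);
  repeat progress rewrite ?(uqF M) ?(uqL M);
  repeat progress rewrite ?(uqE M q0) ?(uqL M);
  repeat progress rewrite ?(uqS M) ?(uqL M) ?(uqE M q0).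
Ltac uq_eq F q0 q2 := lmod F; repeat split;
  try by [ring | field; rewrite ?q0 ?subr_eq0 ?q2].

(** * The normal elements *)

Section NormalElement.
Variables (F : fieldType) (q : F) (V : lmodType F) (M : uq_module q V).
Hypotheses (q0 : q != 0) (q2 : q ^+ 2 != 1).
Local Notation e1 := (e1 M). Local Notation e2 := (e2 M).
Local Notation f1 := (f1 M). Local Notation f2 := (f2 M).
Local Notation k1 := (k1 M). Local Notation k2 := (k2 M).
Local Notation k1i := (k1i M). Local Notation k2i := (k2i M).

Definition kc x := k1 (k2 (k2 x)).
Definition kci x := k1i (k2i (k2i x)).

(* This is (q - q^-1)^2 C1, and the parameter c of the sections below is its
   eigenvalue.  The definition is locked, like the next ones, lest unification
   see the sum through it and distribute operators over it. *)
Definition cas x :=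
  locked ((q - q^-1) ^+ 2 *: f1 (e1 x) + q *: k1 x + q^-1 *: k1i x).

Lemma casE x :
  cas x = (q - q^-1) ^+ 2 *: f1 (e1 x) + q *: k1 x + q^-1 *: k1i x.
Proof. by rewrite /cas -lock. Qed.

(* The quantum trace over a three-dimensional representation gives a central
   element if a cube root of K is adjoined to U, and y1 is that element up to a
   power of this root. *)
Definition y1 x := locked (cas x + q ^- 3 *: kci x +
  (q - q^-1) ^+ 2 *:
   (q ^- 2 *: f2 (e2 (k1i (k2i x)))
    - q^-1 *: (f1 (f2 (e1 (e2 (k2i x)) - q^-1 *: e2 (e1 (k2i x))))
               - q *: f2 (f1 (e1 (e2 (k2i x)) - q^-1 *: e2 (e1 (k2i x))))))).

Lemma y1E x : y1 x = cas x + q ^- 3 *: kci x +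
  (q - q^-1) ^+ 2 *:
   (q ^- 2 *: f2 (e2 (k1i (k2i x)))
    - q^-1 *: (f1 (f2 (e1 (e2 (k2i x)) - q^-1 *: e2 (e1 (k2i x))))
               - q *: f2 (f1 (e1 (e2 (k2i x)) - q^-1 *: e2 (e1 (k2i x)))))).
Proof. by rewrite /y1 -lock. Qed.

Lemma kc_linear : linear kc.
Proof. by move=> a x y; rewrite /kc !(uqL M). Qed.
Lemma kci_linear : linear kci.
Proof. by move=> a x y; rewrite /kci !(uqL M). Qed.
Lemma cas_linear : linear cas.
Proof. move=> a x y; rewrite !casE !(uqL M); lmod F; repeat split; ring. Qed.
Lemma y1_linear : linear y1.
Proof.
by move=> a x y; rewrite !y1E cas_linear kci_linear !(uqL M); lmod F; repeat split; ring.
Qed.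
HB.instance Definition _ := GRing.isLinear.Build F V V *:%R kc kc_linear.
HB.instance Definition _ := GRing.isLinear.Build F V V *:%R kci kci_linear.
HB.instance Definition _ := GRing.isLinear.Build F V V *:%R cas cas_linear.
HB.instance Definition _ := GRing.isLinear.Build F V V *:%R y1 y1_linear.

(** Here and in the next five identities both sides are brought to the order F, E, K and compared
    coefficientwise. The factors q^-1 at [e2] and q at [f2] are those of a central element times
    K^(-1/3), since K E2 = q^3 E2 K. *)
Lemma y1e1 x : y1 (e1 x) = e1 (y1 x).
Proof. rewrite !y1E !casE /kci. uq_nf M q0. uq_eq F q0 q2. Qed.
Lemma y1f1 x : y1 (f1 x) = f1 (y1 x).
Proof. rewrite !y1E !casE /kci. uq_nf M q0. uq_eq F q0 q2. Qed.
Lemma y1e2 x : y1 (e2 x) = q^-1 *: e2 (y1 x).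
Proof. rewrite !y1E !casE /kci. uq_nf M q0. uq_eq F q0 q2. Qed.
Lemma y1f2 x : y1 (f2 x) = q *: f2 (y1 x).
Proof. rewrite !y1E !casE /kci. uq_nf M q0. uq_eq F q0 q2. Qed.
Lemma y1k1 x : y1 (k1 x) = k1 (y1 x).
Proof. rewrite !y1E !casE /kci. uq_nf M q0. uq_eq F q0 q2. Qed.
Lemma y1k2 x : y1 (k2 x) = k2 (y1 x).
Proof. rewrite !y1E !casE /kci. uq_nf M q0. uq_eq F q0 q2. Qed.
End NormalElement.

Section Bar.
Variables (F : fieldType) (q : F) (V : lmodType F) (M : uq_module q V).
Hypothesis q0 : q != 0.

(* The relations are invariant under q -> q^-1, K_i -> K_i^-1. *)
Definition bar : uq_module q^-1 V.
Proof.
refine (@UqModule F q^-1 V (e1 M) (e2 M) (f1 M) (f2 M) (k1i M) (k2i M)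
  (k1 M) (k2 M) (k1iK M) (k1K M) (k2iK M) (k2K M) (k2ik1i M)
  _ _ _ _ _ _ _ _ _ _ (e1f2 M) (e2f1 M) _ _ _ _) => x.
- by rewrite k1ie1 // exprVn.
- by rewrite k1ie2 // invrK.
- by rewrite k2ie1 // invrK.
- by rewrite k2ie2 // exprVn.
- by rewrite k1if1 // exprVn invrK.
- by rewrite k1if2.
- by rewrite k2if1.
- by rewrite k2if2 // exprVn invrK.
- by rewrite e1f1 invrK -[q^-1 - q]opprB invrN scaleNr -scalerN opprB.
- by rewrite e2f2 invrK -[q^-1 - q]opprB invrN scaleNr -scalerN opprB.
- by rewrite e112 invrK [q + _]addrC.
- by rewrite e122 invrK [q + _]addrC.
- by rewrite f112 invrK [q + _]addrC.
- by rewrite f122 invrK [q + _]addrC.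
Defined.

Definition y2 x := y1 bar x.
HB.instance Definition _ :=
  GRing.isLinear.Build F V V *:%R y2 (y1_linear bar).
Hypothesis q2 : q ^+ 2 != 1.

Let qV0 : q^-1 != 0. Proof. by rewrite invr_eq0. Qed.
Let qV2 : q^-1 ^+ 2 != 1.
Proof. by rewrite exprVn invr_eq1. Qed.

Lemma y2e1 x : y2 (e1 M x) = e1 M (y2 x).
Proof. exact: (y1e1 bar qV0 qV2). Qed.
Lemma y2f1 x : y2 (f1 M x) = f1 M (y2 x).
Proof. exact: (y1f1 bar qV0 qV2). Qed.
Lemma y2e2 x : y2 (e2 M x) = q *: e2 M (y2 x).
Proof. by rewrite [LHS](y1e2 bar qV0 qV2) invrK. Qed.
Lemma y2f2 x : y2 (f2 M x) = q^-1 *: f2 M (y2 x).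
Proof. exact: (y1f2 bar qV0 qV2). Qed.
Lemma y2k1i x : y2 (k1i M x) = k1i M (y2 x).
Proof. exact: (y1k1 bar). Qed.
Lemma y2k2i x : y2 (k2i M x) = k2i M (y2 x).
Proof. exact: (y1k2 bar). Qed.
Lemma y2k1 x : y2 (k1 M x) = k1 M (y2 x).
Proof. by apply: (can_inj (k1iK M)); rewrite -y2k1i !k1K. Qed.
Lemma y2k2 x : y2 (k2 M x) = k2 M (y2 x).
Proof. by apply: (can_inj (k2iK M)); rewrite -y2k2i !k2K. Qed.
Lemma y1k1i x : y1 M (k1i M x) = k1i M (y1 M x).
Proof. by apply: (can_inj (k1K M)); rewrite -y1k1 // !k1iK. Qed.
Lemma y1k2i x : y1 M (k2i M x) = k2i M (y1 M x).
Proof. by apply: (can_inj (k2K M)); rewrite -y1k2 // !k2iK. Qed.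
End Bar.

(** * The vectors u(n) *)

Section Raising.
Variables (F : fieldType) (q : F) (V : lmodType F) (M : uq_module q V).
Variable alpha : F.
Hypotheses (q0 : q != 0) (qn1 : forall n, (0 < n)%N -> q ^+ n != 1).
Hypothesis a0 : alpha != 0.
Local Notation e1 := (e1 M). Local Notation e2 := (e2 M).
Local Notation f1 := (f1 M). Local Notation f2 := (f2 M).
Local Notation k1 := (k1 M). Local Notation k2 := (k2 M).
Local Notation k1i := (k1i M). Local Notation k2i := (k2i M).
Local Notation kc := (kc M). Local Notation kci := (kci M).
Local Notation cas := (cas M).
Local Notation y1 := (y1 M). Local Notation y2 := (y2 M q0).
Let q2 : q ^+ 2 != 1. Proof. exact: qn1. Qed.

Definition f3 x := locked (f1 (f2 x) - q *: f2 (f1 x)).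
Definition e3 x := locked (e1 (e2 x) - q *: e2 (e1 x)).
Lemma f3E x : f3 x = f1 (f2 x) - q *: f2 (f1 x).
Proof. by rewrite /f3 -lock. Qed.
Lemma e3E x : e3 x = e1 (e2 x) - q *: e2 (e1 x).
Proof. by rewrite /e3 -lock. Qed.

Lemma subqV_neq0 : q - q^-1 != 0.
Proof.
rewrite subr_eq0; apply: contraNneq q2 => qE.
by rewrite expr2 {1}qE mulVf.
Qed.

Lemma kcK : cancel kc kci.
Proof. by move=> x; rewrite /kc /kci !(uqE M q0). Qed.
Lemma kciK : cancel kci kc.
Proof. by move=> x; rewrite /kc /kci !(uqE M q0). Qed.
Lemma kce1 x : kc (e1 x) = e1 (kc x).
Proof. rewrite /kc; uq_nf M q0; uq_eq F q0 q2. Qed.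
Lemma kce2 x : kc (e2 x) = q ^+ 3 *: e2 (kc x).
Proof. rewrite /kc; uq_nf M q0; uq_eq F q0 q2. Qed.
Lemma kcf1 x : kc (f1 x) = f1 (kc x).
Proof. rewrite /kc; uq_nf M q0; uq_eq F q0 q2. Qed.
Lemma kcf2 x : kc (f2 x) = q ^- 3 *: f2 (kc x).
Proof. rewrite /kc; uq_nf M q0; uq_eq F q0 q2. Qed.
Lemma kck1 x : kc (k1 x) = k1 (kc x).
Proof. by rewrite /kc !(uqE M q0). Qed.
Lemma kck2 x : kc (k2 x) = k2 (kc x).
Proof. by rewrite /kc !(uqE M q0). Qed.
Lemma kck1i x : kc (k1i x) = k1i (kc x).
Proof. by rewrite /kc !(uqE M q0). Qed.
Lemma kck2i x : kc (k2i x) = k2i (kc x).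
Proof. by rewrite /kc !(uqE M q0). Qed.

Lemma e1f3 x : e1 (f3 x) = f3 (e1 x) + f2 (k1i x).
Proof. rewrite !f3E; uq_nf M q0; uq_eq F q0 q2. Qed.
Lemma e2f3 x : e2 (f3 x) = f3 (e2 x) - k2 (f1 x).
Proof. rewrite !f3E; uq_nf M q0; uq_eq F q0 q2. Qed.
Lemma f3f2 x : f3 (f2 x) = q^-1 *: f2 (f3 x).
Proof. rewrite !f3E; uq_nf M q0; uq_eq F q0 q2. Qed.
Lemma f3k2 x : f3 (k2 x) = q *: k2 (f3 x).
Proof. rewrite !f3E; uq_nf M q0; uq_eq F q0 q2. Qed.
(** Where E1 acts by a scalar, K2 [e3] behaves like a q-derivative with respect to F2, which later
    allows one to read off powers of F2. *)
Lemma e3f2 x : k2 (e3 (f2 x)) = q ^- 2 *: f2 (k2 (e3 x)) + e1 x.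
Proof. rewrite !e3E; uq_nf M q0; uq_eq F q0 q2. Qed.

(** The symmetry [bar] turns e1 e2 - q^-1 e2 e1, which occurs in [y1], into [e3]. As [e3] kills the
    u(b), it is [y2] rather than [y1] that determines the Casimir on them. *)
Lemma y2E x : y2 x = cas x + q ^+ 3 *: kc x +
  (q - q^-1) ^+ 2 *: (q ^+ 2 *: f2 (e2 (k1 (k2 x))) -
    q *: (f1 (f2 (e3 (k2 x))) - q^-1 *: f2 (f1 (e3 (k2 x))))).
Proof.
rewrite /y2 y1E !casE !e3E /kci /kc /= !exprVn !invrK.
rewrite [RHS]addrC [LHS]addrC; congr (_ + _).
  by rewrite -opprB sqrrN.
by congr (_ + _); rewrite -opprB sqrrN addrAC.
Qed.

(** The coefficients are a_00(1), a_01(1) and a_10(1), so that G v is u(1, 0, 1). The powers of K^-1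
    are kept as operators [kci]: the scalar by which K acts changes by q^-3 at each step, and so one
    [G] serves for all steps. *)
Definition G x := locked (f2 x - q ^- 2 *: f2 (k2 (k2 (kci (kci x)))) +
  (alpha * (q ^+ 2 - 1) * q ^- 2) *: f3 (kci x)).
Lemma raiseE x : G x = f2 x - q ^- 2 *: f2 (k2 (k2 (kci (kci x)))) +
  (alpha * (q ^+ 2 - 1) * q ^- 2) *: f3 (kci x).
Proof. by rewrite /G -lock. Qed.

Lemma f3_linear : linear f3.
Proof. by move=> a x y; rewrite !f3E !(uqL M); lmod F; repeat split; ring. Qed.
HB.instance Definition _ := GRing.isLinear.Build F V V *:%R f3 f3_linear.
Lemma e3_linear : linear e3.
Proof. by move=> a x y; rewrite !e3E !(uqL M); lmod F; repeat split; ring. Qed.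
HB.instance Definition _ := GRing.isLinear.Build F V V *:%R e3 e3_linear.
Lemma G_linear : linear G.
Proof.
move=> a x y; rewrite !raiseE !kci_linear !(uqL M) f3_linear; lmod F; repeat split; ring.
Qed.
HB.instance Definition _ := GRing.isLinear.Build F V V *:%R G G_linear.

Lemma lin_fun_pushE (g : V -> V) : linear g ->
  ((forall x y, g (x + y)%R = (g x + g y)%R) * (forall x, g (- x)%R = (- g x)%R)
   * (forall c x, g (c *: x) = c *: g x))%type.
Proof.
move=> gL; pose L := GRing.isLinear.Build F V V *:%R g gL.
exact: (lin_pushE (HB.pack g L : {linear V -> V})).
Qed.

Definition uqL2 := (lin_fun_pushE (kc_linear M), lin_fun_pushE (kci_linear M),
  lin_fun_pushE (cas_linear M), lin_fun_pushE f3_linear,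
  lin_fun_pushE e3_linear, lin_fun_pushE G_linear, uqL M).

Lemma kcf3 x : kc (f3 x) = q ^- 3 *: f3 (kc x).
Proof. by rewrite !f3E !(uqL2, kcf1, kcf2); uq_eq F q0 q2. Qed.

Lemma kcG x : kc (G x) = q ^- 3 *: G (kc x).
Proof. by rewrite !raiseE !(uqL2, kcf2, kcf3, kck2, kciK, kcK); uq_eq F q0 q2. Qed.

Lemma kciE kappa x : kappa != 0 -> kc x = kappa *: x -> kci x = kappa^-1 *: x.
Proof.
move=> kp0 kx; apply: (can_inj kcK); rewrite kciK !uqL2 kx scalerA.
by rewrite mulVf // scale1r.
Qed.

Section Raise.
Variables (kappa : F) (x : V).
Hypotheses (kp0 : kappa != 0) (kx : kc x = kappa *: x) (ex : e1 x = alpha *: x).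

Lemma GE : G x = f2 x - (q ^- 2 * kappa ^- 2) *: f2 (k2 (k2 x)) +
  (alpha * (q ^+ 2 - 1) * q ^- 2 * kappa^-1) *: f3 x.
Proof.
by rewrite !raiseE !(kciE kp0 kx, uqL2); uq_eq F q0 q2; field; rewrite ?q0 ?kp0.
Qed.

Lemma k1E : k1 x = kappa *: k2i (k2i x).
Proof. by rewrite -!uqL2 -kx /kc -!(k2k1 M) !k2K. Qed.
Lemma k1iE : k1i x = kappa^-1 *: k2 (k2 x).
Proof. by rewrite -!uqL2 -(kciE kp0 kx) /kci -!(k2ik1i M) !k2iK. Qed.

Lemma e1k2 y : e1 (k2 y) = q *: k2 (e1 y).
Proof. by rewrite (k2e1 M) scalerA mulfV // scale1r. Qed.
Lemma e1k2i y : e1 (k2i y) = q^-1 *: k2i (e1 y).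
Proof. by rewrite (k2ie1 M q0) scalerA mulVf // scale1r. Qed.

(** Since E1 K2^2 = q^2 K2^2 E1, the term with K2^2 alone would spoil the eigenvalue. The
    coefficient of F3 is such that the commutator F2 K1^-1 of E1 and F3, equal to kappa^-1 F2 K2^2
    on [x], repairs this. *)
Lemma e1G : e1 (G x) = alpha *: G x.
Proof.
rewrite GE !(uqL2, e1f2, e1f3, e1k2, ex, k1iE).
by uq_eq F q0 q2; field; rewrite ?q0 ?kp0.
Qed.

Let tau := alpha * (q ^+ 2 - 1) * q ^- 2.
Let tau0 : tau != 0.
Proof. by rewrite !mulf_neq0 ?invr_eq0 ?expf_neq0 ?subr_eq0. Qed.

Lemma e2k2 y : e2 (k2 y) = q ^- 2 *: k2 (e2 y).
Proof. by rewrite (k2e2 M) scalerA mulVf ?scale1r // expf_neq0. Qed.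
Lemma e2k2i y : e2 (k2i y) = q ^+ 2 *: k2i (e2 y).
Proof. by rewrite (k2ie2 M q0) scalerA mulfV ?scale1r // expf_neq0. Qed.

Lemma cas_e1E : (q - q^-1) ^+ 2 *: f1 (e1 x) =
  cas x - (q * kappa) *: k2i (k2i x) - (q^-1 / kappa) *: k2 (k2 x).
Proof. by rewrite casE k1E k1iE; uq_eq F q0 q2. Qed.

(* e2 x = g k2 y forces e3 x = 0, and then y2 determines the Casimir on x. *)
Lemma f1_lower g theta y : e1 y = alpha *: y -> e2 x = g *: k2 y ->
  y2 x = theta *: x ->
  f1 x = ((q - q^-1) ^+ 2 * alpha)^-1 *: ((theta - q ^+ 3 * kappa) *: x
     - ((q - q^-1) ^+ 2 * q ^+ 4 * kappa * g) *: f2 y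
     - (q * kappa) *: k2i (k2i x) - (q^-1 / kappa) *: k2 (k2 x)).
Proof.
move=> ey e2x yx.
have d0 : (q - q^-1) ^+ 2 != 0 by rewrite expf_neq0 // subqV_neq0.
have e3x : e3 (k2 x) = 0.
  rewrite !e3E !(uqL2, e2k2, e1k2, e2x, ex, ey).
  by uq_eq F q0 q2.
have thE : theta *: x = cas x + (q ^+ 3 * kappa) *: x +
    ((q - q^-1) ^+ 2 * q ^+ 4 * kappa * g) *: f2 y.
  rewrite -yx y2E e3x kx -(k2k1 M) k1E !linear0 ?scaler0 ?subr0.
  rewrite !(uqL2, k2iK M, e2k2i, e2x, k2K M).
  by uq_eq F q0 q2.
have casE : cas x = theta *: x - (q ^+ 3 * kappa) *: x -
    ((q - q^-1) ^+ 2 * q ^+ 4 * kappa * g) *: f2 y.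
  by rewrite thE; uq_eq F q0 q2.
have := cas_e1E; rewrite ex uqL2 scalerA casE => dE.
apply: (scalerI (mulf_neq0 d0 a0)); rewrite dE scalerA mulfV.
  by rewrite scale1r; uq_eq F q0 q2.
by rewrite !mulf_neq0 ?subqV_neq0.
Qed.

(** The last hypothesis is x = G y solved for F3 y and multiplied by [g]; in it q^3 kappa is the
    K-eigenvalue of [y]. The factor [g] lets it cover the start of the recursion, where g = 0 and
    [x] need not be of the form G y. *)
Lemma e2_raise g theta y :
  e1 y = alpha *: y -> e2 x = g *: k2 y -> y2 x = theta *: x ->
  g *: f3 y = (g * (q ^+ 3 * kappa) / tau) *: (x - f2 y +
    (q ^- 2 * (q ^+ 3 * kappa) ^- 2) *: f2 (k2 (k2 y))) ->
  e2 (G x) = (q ^+ 4 * g + (1 + q ^+ 2 + q ^- 2 * kappa ^- 2 -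
    q^-1 * kappa^-1 * theta) / (q - q^-1)) *: k2 x.
Proof.
move=> ey e2x yx f3y.
have qq : q ^+ 2 - 1 != 0 by rewrite subr_eq0.
have f3e2 : f3 (e2 x) = (g * (q ^+ 3 * kappa) / tau * q) *: (k2 x -
    q ^- 2 *: f2 (k2 y) +
    (q ^- 4 * (q ^+ 3 * kappa) ^- 2) *: f2 (k2 (k2 (k2 y)))).
  transitivity (q *: k2 (g *: f3 y)).
    by rewrite e2x (lin_fun_pushE f3_linear) f3k2 (linearZ_LR k2) !scalerA mulrC.
  rewrite f3y !(uqL2, k2f2 M).
  by uq_eq F q0 q2; field; rewrite q0 kp0 tau0.
rewrite GE !(uqL2, e2f2 M, e2k2, e2x, e2f3, f3e2) (f1_lower ey e2x yx).
rewrite !(uqL2, k2f2 M, k2iK M, k2K M).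
rewrite /tau.
by uq_eq F q0 q2; field; rewrite q0 kp0 a0 subr_eq0 q2.
Qed.

End Raise.

End Raising.

Section WhittakerVectors.
Variables (F : fieldType) (q : F) (V : lmodType F) (M : uq_module q V).
Variable alpha : F.
Hypotheses (q0 : q != 0) (qn1 : forall n, (0 < n)%N -> q ^+ n != 1).
Hypothesis a0 : alpha != 0.
Local Notation e1 := (e1 M). Local Notation e2 := (e2 M).
Local Notation f1 := (f1 M). Local Notation f2 := (f2 M).
Local Notation k1 := (k1 M). Local Notation k2 := (k2 M).
Local Notation k1i := (k1i M). Local Notation k2i := (k2i M).
Local Notation kc := (kc M). Local Notation kci := (kci M).
Local Notation cas := (cas M).
Local Notation y1 := (y1 M). Local Notation y2 := (y2 M q0).
Let q2 : q ^+ 2 != 1. Proof. exact: qn1. Qed.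

Local Notation f3 := (f3 M).
Local Notation e3 := (e3 M).
Local Notation G := (G M alpha).
Local Notation uqL2 := (uqL2 M alpha).

Lemma y2_linear : linear y2.
Proof. exact: (y1_linear (bar M q0)). Qed.

Lemma y2f3 x : y2 (f3 x) = q^-1 *: f3 (y2 x).
Proof.
rewrite !f3E !(lin_fun_pushE y2_linear) !(y2f1, y2f2) // !(uqL M).
by uq_eq F q0 q2.
Qed.

Lemma y2kci x : y2 (kci x) = kci (y2 x).
Proof. by rewrite /kci !(y2k1i, y2k2i). Qed.

Lemma y2G x : y2 (G x) = q^-1 *: G (y2 x).
Proof.
rewrite !raiseE !(lin_fun_pushE y2_linear, y2f2, y2f3, y2k2, y2kci) //.
by uq_eq F q0 q2.
Qed.

(** [w] may be 0; its nonvanishing is assumed separately where it matters. *)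
Record whittaker (kappa c : F) (w : V) : Prop := Whittaker {
  wh_e1 : e1 w = alpha *: w;
  wh_e2 : e2 w = 0;
  wh_kc : kc w = kappa *: w;
  wh_cas : cas w = c *: w;
  wh_neq0 : kappa != 0 }.

Section Sequence.
Variables (kappa c : F) (w : V).
Hypothesis ww : whittaker kappa c w.
Let kp0 := wh_neq0 ww.

Definition u b := iter b G w.
Definition hv b :=
  q ^+ 3 * q ^- (2 * b) * kappa + q ^- 3 * q ^+ (2 * b) / kappa - c.
(** The solution, started at 0, of the recursion that [e2_raise] gives for the factor [g]. For b > 0
    the factor q^(2b) - 1 is nonzero, so [low b] vanishes exactly when [hv b] does. *)
Definition low b := (q ^+ (2 * b) - 1) * q ^+ (2 * b) * q ^- 4 / kappa
  / (q - q^-1) ^+ 2 * hv b.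

Lemma uS b : u b.+1 = G (u b).
Proof. by []. Qed.

Lemma kc_u b : kc (u b) = (q ^- (3 * b) * kappa) *: u b.
Proof.
elim: b => [|b IHb]; first by rewrite muln0 invr1 mul1r (wh_kc ww).
rewrite uS kcG // IHb uqL2 scalerA; congr (_ *: _).
by rewrite mulrA -invfM -exprD mulnS.
Qed.

Let kpb b : q ^- (3 * b) * kappa != 0.
Proof. by rewrite mulf_neq0 // invr_eq0 expf_neq0. Qed.

Lemma e1_u b : e1 (u b) = alpha *: u b.
Proof.
elim: b => [|b IHb]; first exact: wh_e1 ww.
by apply: (e1G q0 qn1 (kpb b) (kc_u b)).
Qed.

(** [y2] q-commutes with [G], because F2 and F3 both have degree one in F2; at [w] only the Casimir
    and q^3 K survive in [y2]. *)
Lemma y2_u b : y2 (u b) = (q ^- b * (c + q ^+ 3 * kappa)) *: u b.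
Proof.
elim: b => [|b IHb]; last first.
  rewrite uS y2G // IHb uqL2 scalerA; congr (_ *: _).
  by rewrite mulrA -invfM -exprS.
rewrite invr1 mul1r (y2E M) // (wh_cas ww) (wh_kc ww) -(k2k1 M).
rewrite (k1E (wh_kc ww)) e3E !(uqL2, k2iK M, e2k2i, e2k2, e1k2) //.
rewrite (wh_e2 ww) (wh_e1 ww) !uqL2 (wh_e2 ww) !(linear0, subr0, addr0).
by rewrite scalerA -scalerDl.
Qed.

Lemma e2_u b : e2 (u b) = low b *: k2 (u b.-1).
Proof.
elim: b => [|b IHb].
  by rewrite /low muln0 subrr !mul0r scale0r (wh_e2 ww).
(* f3 (u b.-1) is recovered from u b = G (u b.-1); if b = 0, low b = 0. *)
have [y [ey e2y f3y]] : exists y, [/\ e1 y = alpha *: y,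
    e2 (u b) = low b *: k2 y &
    low b *: f3 y = (low b * (q ^+ 3 * (q ^- (3 * b) * kappa)) /
      (alpha * (q ^+ 2 - 1) * q ^- 2)) *: (u b - f2 y +
    (q ^- 2 * (q ^+ 3 * (q ^- (3 * b) * kappa)) ^- 2) *: f2 (k2 (k2 y)))].
  exists (u b.-1); split=> //; first exact: e1_u.
  case: (b) => [|d]; first by rewrite /low muln0 subrr !mul0r !scale0r.
  rewrite succnK.
  have -> : q ^+ 3 * (q ^- (3 * d.+1) * kappa) = q ^- (3 * d) * kappa.
    by rewrite mulrA mulnS exprD invfM mulrA mulfV ?mul1r ?expf_neq0.
  have t0 : alpha * (q ^+ 2 - 1) * q ^- 2 != 0.
    by rewrite !mulf_neq0 ?invr_eq0 ?expf_neq0 ?subr_eq0 ?qn1.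
  rewrite uS (GE alpha q0 (kpb d) (kc_u d)).
  rewrite -mulrA -scalerA; congr (_ *: _).
  set t := alpha * _ * _ in t0 *; set p := q ^- _ * kappa.
  have p0 : p != 0 := kpb d.
  by lmod F; repeat split; field; rewrite ?q0 ?p0 ?t0.
rewrite uS (e2_raise qn1 a0 (kpb b) (kc_u b) (e1_u b) ey e2y (y2_u b) f3y).
congr (_ *: _); rewrite /low /hv !mulnS !exprD.
have qb0 : q ^+ b != 0 by rewrite expf_neq0.
by field; rewrite q0 qb0 kp0 subr_eq0 q2.
Qed.

End Sequence.

End WhittakerVectors.

(** * The vectors K2^l F2^a u(b) and the action of the generators on their span *)

Section Span.
Variables (F : fieldType) (q : F) (V : lmodType F) (M : uq_module q V).
Variable alpha : F.
Hypotheses (q0 : q != 0) (qn1 : forall n, (0 < n)%N -> q ^+ n != 1).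
Hypothesis a0 : alpha != 0.
Local Notation e1 := (e1 M). Local Notation e2 := (e2 M).
Local Notation f1 := (f1 M). Local Notation f2 := (f2 M).
Local Notation k1 := (k1 M). Local Notation k2 := (k2 M).
Local Notation k1i := (k1i M). Local Notation k2i := (k2i M).
Local Notation kc := (kc M). Local Notation kci := (kci M).
Local Notation cas := (cas M).
Local Notation y1 := (y1 M). Local Notation y2 := (y2 M q0).
Let q2 : q ^+ 2 != 1. Proof. exact: qn1. Qed.

Local Notation f3 := (f3 M).
Local Notation e3 := (e3 M).
Local Notation G := (G M alpha).
Local Notation uqL2 := (uqL2 M alpha).

Variables (kappa c : F) (w : V).
Hypothesis ww : whittaker M alpha kappa c w.
Local Notation u b := (u M alpha w b).
Local Notation low := (low q kappa c).
Let kp0 := wh_neq0 ww.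
Let e1u b : e1 (u b) = alpha *: u b. Proof. exact: (e1_u q0 qn1 ww). Qed.
Let e2u b : e2 (u b) = low b *: k2 (u b.-1). Proof. exact: (e2_u q0 qn1 a0 ww). Qed.
Let kcu b : kc (u b) = (q ^- (3 * b) * kappa) *: u b. Proof. exact: (kc_u q0 ww). Qed.
Let y2u b : y2 (u b) = (q ^- b * (c + q ^+ 3 * kappa)) *: u b.
Proof. exact: (y2_u q0 qn1 ww). Qed.

(** E1 K2 = q K2 E1, and this q cancels the one in [e3]. *)
Lemma e3_u b : e3 (u b) = 0.
Proof.
rewrite e3E e2u !(e1u, e1k2, uqL2) // e2u.
by lmod F; repeat split; ring.
Qed.

Definition w3 x := k2 (e3 x).

Lemma geom_neq0 n : \sum_(i < n.+1) (q ^- 2) ^+ i != 0.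
Proof.
have := qn1 (isT : (0 < 2 * n.+1)%N); apply: contraNneq => s0.
have /eqP := subrX1 (q ^- 2) n.+1; rewrite s0 mulr0 subr_eq0 exprVn -exprM.
by rewrite invr_eq1.
Qed.

Lemma e1_f2u a b : e1 (iter a f2 (u b)) = alpha *: iter a f2 (u b).
Proof.
by elim: a => [|a IHa]; [exact: e1u|rewrite iterS (e1f2 M) IHa uqL2].
Qed.

(** By [e3f2], passing one F2 multiplies by q^-2 and adds [alpha]. The truncated exponent [a.-1] at
    a = 0 is harmless because the sum is then empty. *)
Lemma w3_f2u a b : w3 (iter a f2 (u b)) =
  (alpha * \sum_(i < a) (q ^- 2) ^+ i) *: iter a.-1 f2 (u b).
Proof.
elim: a => [|a IHa].
  by rewrite big_ord0 mulr0 scale0r /w3 e3_u linear0.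
rewrite iterS /w3 e3f2 // -/(w3 _) IHa e1_f2u big_ord_recl expr0.
case: a {IHa} => [|a].
  by rewrite !big_ord0 mulr0 scale0r linear0 scaler0 add0r addr0 mulr1.
rewrite !uqL2 scalerA -scalerDl mulrDr mulr1 addrC; congr ((_ + _) *: _).
rewrite mulrCA; congr (_ * _); rewrite mulr_sumr.
by apply: eq_bigr => i _; rewrite -exprS.
Qed.

Lemma w3_iter_eq0 m a b : (a < m)%N -> iter m w3 (iter a f2 (u b)) = 0.
Proof.
have w30 n : iter n w3 0 = 0 by elim: n => [|n] //= ->; rewrite /w3 !linear0.
have w3Z n d x : iter n w3 (d *: x) = d *: iter n w3 x.
  by elim: n x => [//|n IHn] x; rewrite !iterS IHn /w3 !uqL2.
elim: m a => [//|m IHm] [|a] am; rewrite iterSr w3_f2u w3Z.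
  by rewrite big_ord0 mulr0 scale0r.
by rewrite IHm ?scaler0.
Qed.

Lemma w3_iter_neq0 a b :
  exists2 d, d != 0 & iter a w3 (iter a f2 (u b)) = d *: u b.
Proof.
elim: a => [|a [d d0 IHa]]; first by exists 1; rewrite ?oner_neq0 ?scale1r.
have w3Z n d' x : iter n w3 (d' *: x) = d' *: iter n w3 x.
  by elim: n x => [//|n IHn] x; rewrite !iterS IHn /w3 !uqL2.
exists (alpha * (\sum_(i < a.+1) (q ^- 2) ^+ i) * d).
  by rewrite !mulf_neq0 ?geom_neq0.
by rewrite iterSr w3_f2u w3Z IHa scalerA.
Qed.

Definition k2z (l : int) (x : V) : V :=
  match l with Posz n => iter n k2 x | Negz n => iter n.+1 k2i x end.

Lemma k2zD1 l x : k2 (k2z l x) = k2z (l + 1) x.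
Proof.
case: l => n; first by rewrite addrC.
case: n => [|n]; first by rewrite /= k2iK.
have -> : Negz n.+1 + 1 = Negz n by rewrite !NegzE -[n.+2]addn1 PoszD opprD addrNK.
by rewrite /= k2iK.
Qed.

Lemma k2zB1 l x : k2i (k2z l x) = k2z (l - 1) x.
Proof. by rewrite -[l in LHS](subrK 1) -k2zD1 k2K. Qed.

Lemma int_step_ind (P : int -> Prop) :
  P 0 -> (forall l, P l -> P (l + 1)) -> (forall l, P l -> P (l - 1)) ->
  forall l, P l.
Proof.
move=> P0 PS PP; elim=> [//|n /PS|n /PP]; first by rewrite -PoszD addn1.
by rewrite -opprD -PoszD addn1.
Qed.

Lemma k2zD l m x : k2z (l + m) x = k2z l (k2z m x).
Proof.
elim/int_step_ind: l x => [|l IHl|l IHl] x; first by rewrite add0r.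
  by rewrite addrAC -!k2zD1 IHl.
by rewrite addrAC -!k2zB1 IHl.
Qed.

Lemma k2zNK l x : k2z (- l) (k2z l x) = x.
Proof. by rewrite -k2zD addNr. Qed.

Lemma k2z_linear l : linear (k2z l).
Proof.
elim/int_step_ind: l => [//|l IHl|l IHl] a x y.
  by rewrite -!k2zD1 IHl !uqL2.
by rewrite -!k2zB1 IHl !uqL2.
Qed.

Lemma k2z_comm (g : V -> V) d : linear g -> d != 0 ->
  (forall x, g (k2 x) = d *: k2 (g x)) ->
  forall l x, g (k2z l x) = d ^ l *: k2z l (g x).
Proof.
move=> gL d0 gk l; have gZ := (lin_fun_pushE gL).2.
have gki x : g (k2i x) = d^-1 *: k2i (g x).
  by rewrite -[in RHS](k2iK M x) gk uqL2 k2K scalerA mulVf ?scale1r.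
elim/int_step_ind: l => [|l IHl|l IHl] x; first by rewrite scale1r.
  by rewrite -!k2zD1 gk IHl uqL2 scalerA exprzDr ?unitfE // expr1z mulrC.
by rewrite -!k2zB1 gki IHl uqL2 scalerA exprzDr ?unitfE // exprN1 mulrC.
Qed.

Definition stdvec l a b := k2z l (iter a f2 (u b)).

Lemma kc_stdvec l a b :
  kc (stdvec l a b) = (q ^- (3 * (a + b)) * kappa) *: stdvec l a b.
Proof.
rewrite /stdvec (k2z_comm (kc_linear M) (oner_neq0 _)) => [|x]; last first.
  by rewrite kck2 // scale1r.
rewrite exp1rz scale1r -(lin_fun_pushE (k2z_linear l)).2; congr (k2z l _).
elim: a => [|a IHa]; first exact: kcu.
rewrite iterS kcf2 // IHa uqL2 scalerA; congr (_ *: _).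
by rewrite mulrA -invfM -exprD addSn mulnS.
Qed.

(** E1 takes the role of a Cartan element: it is diagonal on these vectors and its eigenvalue
    records the power of K2, on which K2 itself acts as a shift. *)
Lemma e1_stdvec l a b : e1 (stdvec l a b) = (q ^ l * alpha) *: stdvec l a b.
Proof.
rewrite /stdvec (k2z_comm (linearP e1) q0 (e1k2 M q0)) e1_f2u.
by rewrite (lin_fun_pushE (k2z_linear l)).2 scalerA.
Qed.

Definition spanu := span (fun x => exists l a b, x = stdvec l a b).

Let spS : subspace spanu := span_subspace _.

Lemma spanu_std l a b : spanu (stdvec l a b).
Proof. by apply: span_gen; exists l, a, b. Qed.

Lemma spanu_ext (g : V -> V) : linear g ->
  (forall l a b, spanu (g (stdvec l a b))) -> forall x, spanu x -> spanu (g x).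
Proof.
move=> gL gstd; pose L := GRing.isLinear.Build F V V *:%R g gL.
apply: span_min => [|_ [l [a [b ->]]] //].
exact: (preim_subspace (HB.pack g L : {linear V -> V}) spS).
Qed.

Lemma spanu_k2z m x : spanu x -> spanu (k2z m x).
Proof.
by apply: (spanu_ext (k2z_linear m)) => l a b; rewrite -k2zD; apply: spanu_std.
Qed.

Lemma spanu_k2 x : spanu x -> spanu (k2 x).
Proof. exact: (@spanu_k2z 1). Qed.
Lemma spanu_k2i x : spanu x -> spanu (k2i x).
Proof. exact: (@spanu_k2z (- 1)). Qed.

Lemma spanu_comm (g : V -> V) d : linear g -> d != 0 ->
  (forall x, g (k2 x) = d *: k2 (g x)) ->
  (forall a b, spanu (g (iter a f2 (u b)))) -> forall x, spanu x -> spanu (g x).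
Proof.
move=> gL d0 gk gab; apply: (spanu_ext gL) => l a b.
rewrite /stdvec (k2z_comm gL d0 gk); apply: (subZ spS); exact: spanu_k2z.
Qed.

Lemma spanu_f2 x : spanu x -> spanu (f2 x).
Proof.
apply: (spanu_comm (linearP f2) (expf_neq0 2 q0)) => [y|a b].
  by rewrite (k2f2 M) scalerA mulfV ?scale1r ?expf_neq0.
exact: (spanu_std 0 a.+1).
Qed.

Lemma spanu_u b : spanu (u b). Proof. exact: (spanu_std 0 0). Qed.

Let kpb b : q ^- (3 * b) * kappa != 0.
Proof. by rewrite mulf_neq0 // invr_eq0 expf_neq0. Qed.

(** The equation u(b+1) = G u(b) is solved for F3 u(b), the coefficient of F3 being nonzero; F2 and
    K2 are then passed by q-commutation. *)
Lemma spanu_f3 x : spanu x -> spanu (f3 x).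
Proof.
apply: (spanu_comm (f3_linear M) q0) => [y|a b]; first exact: f3k2.
elim: a => [|a IHa]; last first.
  by rewrite iterS f3f2 //; apply: (subZ spS); apply: spanu_f2.
have := GE alpha q0 (kpb b) (kcu b); rewrite /= -[G (u b)]/(u b.+1).
set t := (alpha * _ * _ / _).
have t0 : t != 0.
  by rewrite !mulf_neq0 ?invr_eq0 ?expf_neq0 ?subr_eq0 ?qn1.
move/eqP; rewrite addrC -subr_eq => /eqP f3E'.
apply: (subZr spS t0); rewrite -f3E'.
apply: (subB spS (spanu_u _)); apply: (subB spS); first exact/spanu_f2/spanu_u.
by apply: (subZ spS); do 3 apply/spanu_f2 || apply: spanu_k2; exact: spanu_u.
Qed.

(** F1 F2 = F3 + q F2 F1 reduces the claim to F1 u(b), which [f1_lower] expresses through u(b) and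
    u(b-1). At b = 0 the truncated [b.-1] comes with the factor [low 0], which is 0. *)
Lemma spanu_f1 x : spanu x -> spanu (f1 x).
Proof.
apply: (spanu_comm (linearP f1) (_ : q^-1 != 0)) => [|y|a b].
- by rewrite invr_eq0.
- by rewrite (k2f1 M) scalerA mulVf // scale1r.
elim: a => [|a IHa]; last first.
  have -> : f1 (iter a.+1 f2 (u b)) =
      f3 (iter a f2 (u b)) + q *: f2 (f1 (iter a f2 (u b))).
    by rewrite f3E subrK.
  apply: (subD spS); first exact/spanu_f3/(spanu_std 0).
  by apply: (subZ spS); apply: spanu_f2.
rewrite [f1 _](f1_lower qn1 a0 (kpb b) (kcu b) (e1u b) (e1u b.-1) (e2u b) (y2u b)).
by do ! [exact: spanu_u | apply: (subB spS) | apply: (subZ spS) |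
  apply: spanu_f2 | apply: spanu_k2 | apply: spanu_k2i].
Qed.

Lemma spanu_e1 x : spanu x -> spanu (e1 x).
Proof.
apply: (spanu_ext (linearP e1)) => l a b.
by rewrite e1_stdvec; apply: (subZ spS); apply: spanu_std.
Qed.

Lemma spanu_e2 x : spanu x -> spanu (e2 x).
Proof.
apply: (spanu_comm (linearP e2) (_ : q ^- 2 != 0)) => [|y|a b].
- by rewrite invr_eq0 expf_neq0.
- exact: e2k2.
elim: a => [|a IHa] /=; first by rewrite e2u; apply: (subZ spS);
  apply: spanu_k2; exact: spanu_u.
rewrite (e2f2 M); apply: (subD spS); first exact: spanu_f2.
apply: (subZ spS); apply: (subB spS); [apply: spanu_k2|apply: spanu_k2i];
  exact: (spanu_std 0).
Qed.

Lemma spanu_kc x : spanu x -> spanu (kc x).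
Proof.
apply: (spanu_ext (kc_linear M)) => l a b.
by rewrite kc_stdvec; apply: (subZ spS); apply: spanu_std.
Qed.

Lemma spanu_kci x : spanu x -> spanu (kci x).
Proof.
apply: (spanu_ext (kci_linear M)) => l a b.
by rewrite (kciE (kpb _) (kc_stdvec l a b)); apply: (subZ spS);
  apply: spanu_std.
Qed.

Lemma spanu_k1 x : spanu x -> spanu (k1 x).
Proof.
move=> Sx; rewrite -[k1 x](_ : kc (k2i (k2i x)) = _).
  by apply: spanu_kc; do 2 apply: spanu_k2i.
by rewrite /kc !k2iK.
Qed.

Lemma spanu_k1i x : spanu x -> spanu (k1i x).
Proof.
move=> Sx; rewrite -[k1i x](_ : kci (k2 (k2 x)) = _).
  by apply: spanu_kci; do 2 apply: spanu_k2.
by rewrite /kci !k2K.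
Qed.

End Span.

(** * Submodules *)

Section SubmoduleDef.
Variables (F : fieldType) (q : F) (V : lmodType F) (M : uq_module q V).

Record submod (S : V -> Prop) : Prop := Submod {
  submod_sub : subspace S;
  submod_e1 : forall x, S x -> S (e1 M x);
  submod_e2 : forall x, S x -> S (e2 M x);
  submod_f1 : forall x, S x -> S (f1 M x);
  submod_f2 : forall x, S x -> S (f2 M x);
  submod_k1 : forall x, S x -> S (k1 M x);
  submod_k2 : forall x, S x -> S (k2 M x);
  submod_k1i : forall x, S x -> S (k1i M x);
  submod_k2i : forall x, S x -> S (k2i M x) }.

Definition simple := forall S : V -> Prop, submod S ->
  forall x, S x -> x != 0 -> forall y, S y.
End SubmoduleDef.

Section SubmoduleSpan.
Variables (F : fieldType) (q : F) (V : lmodType F) (M : uq_module q V).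
Variable alpha : F.
Hypotheses (q0 : q != 0) (qn1 : forall n, (0 < n)%N -> q ^+ n != 1).
Hypothesis a0 : alpha != 0.
Local Notation e1 := (e1 M). Local Notation e2 := (e2 M).
Local Notation f1 := (f1 M). Local Notation f2 := (f2 M).
Local Notation k1 := (k1 M). Local Notation k2 := (k2 M).
Local Notation k1i := (k1i M). Local Notation k2i := (k2i M).
Local Notation kc := (kc M). Local Notation kci := (kci M).
Local Notation cas := (cas M).
Local Notation y1 := (y1 M). Local Notation y2 := (y2 M q0).
Let q2 : q ^+ 2 != 1. Proof. exact: qn1. Qed.

Local Notation f3 := (f3 M).
Local Notation e3 := (e3 M).
Local Notation G := (G M alpha).
Local Notation uqL2 := (uqL2 M alpha).

Variables (kappa c : F) (w : V).
Hypothesis ww : whittaker M alpha kappa c w.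
Local Notation u b := (u M alpha w b).
Local Notation low := (low q kappa c).
Let kp0 := wh_neq0 ww.
Let e1u b : e1 (u b) = alpha *: u b. Proof. exact: (e1_u q0 qn1 ww). Qed.
Let e2u b : e2 (u b) = low b *: k2 (u b.-1). Proof. exact: (e2_u q0 qn1 a0 ww). Qed.
Let kcu b : kc (u b) = (q ^- (3 * b) * kappa) *: u b. Proof. exact: (kc_u q0 ww). Qed.
Let y2u b : y2 (u b) = (q ^- b * (c + q ^+ 3 * kappa)) *: u b.
Proof. exact: (y2_u q0 qn1 ww). Qed.

Local Notation stdvec := (stdvec M alpha w).
Local Notation spanu := (spanu M alpha w).
Local Notation k2z := (k2z M).

Lemma spanu_submod : submod M spanu.
Proof.
split=> [|x|x|x|x|x|x|x|x]; first exact: span_subspace.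
- exact: (spanu_e1 q0 qn1 ww).
- exact: (spanu_e2 q0 qn1 a0 ww).
- exact: (spanu_f1 q0 qn1 a0 ww).
- exact: (spanu_f2 q0).
- exact: (spanu_k1 q0 ww).
- exact: spanu_k2.
- exact: (spanu_k1i q0 ww).
- exact: spanu_k2i.
Qed.

(** [t.1] is the degree seen by K, and [t.2] the power of K2 seen by E1. *)
Definition wt (t : nat * int) :=
  span (fun y => exists a b, (a + b)%N = t.1 /\ y = stdvec t.2 a b).

Lemma kc_wt t x : wt t x -> kc x = (q ^- (3 * t.1) * kappa) *: x.
Proof.
elim=> {x} [|_ [a [b [<- ->]]]|x y _ IHx _ IHy|d x _ IHx].
- by rewrite scaler0 linear0.
- exact: (kc_stdvec q0 ww).
- by rewrite uqL2 IHx IHy -scalerDr.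
- by rewrite uqL2 IHx !scalerA mulrC.
Qed.

Lemma e1_wt t x : wt t x -> e1 x = (q ^ t.2 * alpha) *: x.
Proof.
elim=> {x} [|_ [a [b [_ ->]]]|x y _ IHx _ IHy|d x _ IHx].
- by rewrite scaler0 linear0.
- exact: (e1_stdvec q0 qn1 ww).
- by rewrite uqL2 IHx IHy -scalerDr.
- by rewrite uqL2 IHx !scalerA mulrC.
Qed.

Lemma spanu_decomp x : spanu x -> exists s y,
  [/\ uniq s, forall t, wt t (y t) & x = \sum_(t <- s) y t].
Proof.
apply: span_decomp => [t|_ [l [a [b ->]]]]; first exact: span_subspace.
by exists ((a + b)%N, l); apply: span_gen; exists a, b.
Qed.

Lemma qz_inj (l m : int) : q ^ l = q ^ m -> l = m.
Proof.
suff pos n d : q ^ n = q ^ (n + Posz d) -> d = 0%N.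
  have [lm|/ltW ml] := lerP l m.
    have := pos l `|m - l|%N; rewrite gez0_abs ?subr_ge0 // subrKC.
    by move=> H /H /eqP; rewrite absz_eq0 subr_eq0 => /eqP.
  have := pos m `|l - m|%N; rewrite gez0_abs ?subr_ge0 // subrKC.
  by move=> H /esym /H /eqP; rewrite absz_eq0 subr_eq0 => /eqP.
rewrite exprzDr ?unitfE // -[LHS]mulr1 => /(mulfI (expfz_neq0 n q0)) /esym.
by case: d => // d /eqP; rewrite -exprnP (negPf (qn1 _)).
Qed.

Lemma wt_separated t t' : t != t' ->
  q ^- (3 * t.1) * kappa != q ^- (3 * t'.1) * kappa \/
  q ^ t.2 * alpha != q ^ t'.2 * alpha.
Proof.
case: t t' => [n l] [n' l'] /=; rewrite xpair_eqE negb_and => /orP[nn|ll].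
  left; apply: contra nn => /eqP /(mulIf kp0) /invr_inj.
  by rewrite !exprnP => /qz_inj [] /eqP; rewrite eqn_pmul2l.
by right; apply: contra ll => /eqP /(mulIf a0) /qz_inj ->.
Qed.

(** Stability is asked for K and E1 only, so that [S] can also be the space of Whittaker vectors or
    the zero subspace. *)
Lemma wt_component S s y : subspace S ->
  (forall x, S x -> S (kc x)) -> (forall x, S x -> S (e1 x)) ->
  uniq s -> (forall t, wt t (y t)) -> S (\sum_(t <- s) y t) ->
  forall t, t \in s -> S (y t).
Proof.
move=> sS Skc Se1; apply: (eig_component sS) => [t|t t' tt'].
  exact: span_subspace.
have [kn|en] := wt_separated tt'.
  by exists kc, (fun t => q ^- (3 * t.1) * kappa); split;
    [exact: Skc|exact: kc_wt|exact: kn].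
by exists e1, (fun t => q ^ t.2 * alpha); split; [exact: Se1|exact: e1_wt|exact: en].
Qed.

Lemma wtE n l x : wt (n, l) x -> exists d : nat -> F,
  x = k2z l (\sum_(a < n.+1) d a *: iter a f2 (u (n - a))).
Proof.
have zL := lin_fun_pushE (k2z_linear M l).
elim=> {x} [|_ [a [b [/= <- ->]]]|x y _ [d ->] _ [d' ->]|k x _ [d ->]].
- exists (fun=> 0); rewrite big1 => [|i _]; last by rewrite scale0r.
  by have := zL.2 0 0; rewrite !scale0r.
- exists (fun i => (i == a)%:R).
  have ai : (a < (a + b).+1)%N by rewrite ltnS leq_addr.
  rewrite (bigD1 (Ordinal ai)) //= eqxx scale1r addKn big1 ?addr0 // => i.
  by rewrite -val_eqE /= => /negPf ->; rewrite scale0r.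
- exists (fun a => d a + d' a); rewrite -zL.1.1 -big_split; congr (k2z l _).
  by apply: eq_bigr => i _; rewrite scalerDl.
- exists (fun a => k * d a); rewrite -zL.2 scaler_sumr; congr (k2z l _).
  by apply: eq_bigr => i _; rewrite scalerA.
Qed.

Section Submodule.
Variable S : V -> Prop.
Hypothesis sS : submod M S.
Let S0 := submod_sub sS.

Lemma submod_k2z l x : S x -> S (k2z l x).
Proof.
elim/int_step_ind: l => [//|l IHl|l IHl] /IHl Sx.
  by rewrite -k2zD1; apply: (submod_k2 sS).
by rewrite -k2zB1; apply: (submod_k2i sS).
Qed.

Lemma submod_f2X n x : S x -> S (iter n f2 x).
Proof. by move=> Sx; elim: n => // n; apply: (submod_f2 sS). Qed.

Lemma submod_w3 n x : S x -> S (iter n (w3 M) x).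
Proof.
move=> Sx; elim: n => // n IHn; rewrite iterS /w3; apply: (submod_k2 sS).
rewrite e3E; apply: (subB S0); last apply: (subZ S0).
  by apply: submod_e1 => //; apply: submod_e2.
by apply: submod_e2 => //; apply: submod_e1.
Qed.

Lemma w3_linear : linear (w3 M).
Proof. by move=> d x y; rewrite /w3 !uqL2. Qed.

(** If F2^m is the highest power in the sum, (K2 E3)^m kills all lower terms and turns the top one
    into a multiple of u(n - m), nonzero if its coefficient is. This term is then subtracted, and
    the argument repeated. *)
Lemma submod_coef m n (d : nat -> F) :
  S (\sum_(a < m) d a *: iter a f2 (u (n - a))) ->
  forall a, (a < m)%N -> d a != 0 -> S (u (n - a)).
Proof.
elim: m => [//|m IHm] Sx.
have Sm : d m != 0 -> S (u (n - m)).
  move=> dm; have := submod_w3 m Sx.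
  have iter_sum k : iter k (w3 M) (\sum_(a < m.+1) d a *: iter a f2 (u (n - a)))
      = \sum_(a < m.+1) d a *: iter k (w3 M) (iter a f2 (u (n - a))).
    elim: k => [//|k IH]; rewrite iterS IH.
    pose L := GRing.isLinear.Build F V V *:%R (w3 M) w3_linear.
    pose g : {linear V -> V} := HB.pack (w3 M) L.
    rewrite -[w3 M]/(g : V -> V) linear_sum.
    by apply: eq_bigr => i _; rewrite linearZ.
  rewrite iter_sum.
  rewrite big_ord_recr big1 ?add0r => [|i _]; last first.
    by rewrite (w3_iter_eq0 q0 qn1 a0 ww _ (ltn_ord i)) ?scaler0.
  have [d' d0 ->] := w3_iter_neq0 q0 qn1 a0 ww m (n - m).
  by rewrite /= add0r scalerA => /(subZr S0); apply; rewrite mulf_neq0.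
move=> a; rewrite ltnS leq_eqVlt => /orP[/eqP -> //|am]; apply: IHm => //.
have [dm|dm] := eqVneq (d m) 0.
  by move: Sx; rewrite big_ord_recr /= dm scale0r addr0.
rewrite -[X in S X](addrK (d m *: iter m f2 (u (n - m)))).
apply: (subB S0); first by move: Sx; rewrite big_ord_recr.
by apply: (subZ S0); apply: submod_f2X; apply: Sm.
Qed.

(** K and E1 separate the degree and the power of K2, so each component lies in [S]. Applying K2^-l
    leaves a sum over powers of F2, to which [submod_coef] applies. *)
Lemma submod_spanu x : S x -> spanu x ->
  span (fun y => exists l a b, S (u b) /\ y = stdvec l a b) x.
Proof.
move=> Sx /spanu_decomp [s [y [us wy xE]]].
have sT := span_subspace
  (fun y => exists l a b, S (u b) /\ y = stdvec l a b).
rewrite xE big_seq; apply: (sub_sum _ sT) => t ts.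
have {ts}Sy : S (y t).
  apply: (wt_component S0 _ _ us wy _ ts); last by rewrite -xE.
    by move=> z Sz; apply: (submod_k1 sS); do 2 apply: (submod_k2 sS).
  exact: submod_e1.
have := wy t; move: Sy; case: t => n l; move: (y (n, l)) => z Sz /wtE[d yE].
have Sd := @submod_coef n.+1 n d.
have /Sd {}Sd : S (\sum_(a < n.+1) d a *: iter a f2 (u (n - a))).
  by rewrite -(k2zNK M l (\sum_(_ < _) _)) -yE; apply: submod_k2z.
rewrite yE; have zL := lin_fun_pushE (k2z_linear M l).
apply: (big_ind (fun z => span _ (k2z l z))) => [|z1 z2 Sz1 Sz2|i _].
- by have := zL.2 0 0; rewrite !scale0r => ->; apply: sub0.
- by rewrite zL.1.1; apply: subD.
rewrite zL.2; have [->|di] := eqVneq (d i) 0.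
  by rewrite scale0r; apply: sub0.
apply: (subZ sT); apply: span_gen; exists l, i, (n - i)%N; split=> //.
exact: Sd.
Qed.

(** Unless [hv b] is 0, E2 u(b) is for b > 0 a nonzero multiple of K2 u(b-1), so one can go down
    inside [S]. *)
Lemma submod_u_descent b : S (u b) ->
  exists2 b', (b' <= b)%N & S (u b') /\ (b' = 0%N \/ hv q kappa c b' = 0).
Proof.
elim: b => [|b IHb] Sb; first by exists 0%N => //; split=> //; left.
have [hb|hb] := eqVneq (hv q kappa c b.+1) 0.
  by exists b.+1 => //; split=> //; right.
have Sb' : S (u b).
  have := submod_e2 sS Sb; rewrite e2u => /(subZr S0) Sk.
  rewrite -[u b](k2K M); apply: (submod_k2i sS); apply: Sk.
  rewrite /low !mulf_neq0 ?invr_eq0 ?expf_neq0 ?subqV_neq0 //.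
  by rewrite subr_eq0 qn1.
by have [b' b'b H] := IHb Sb'; exists b' => //; apply: leqW.
Qed.

End Submodule.

End SubmoduleSpan.

(** * Simple modules *)

Section SimpleModule.
Variables (F : closedFieldType) (q : F) (V : lmodType F) (M : uq_module q V).
Variable alpha : F.
Hypotheses (q0 : q != 0) (qn1 : forall n, (0 < n)%N -> q ^+ n != 1).
Hypothesis a0 : alpha != 0.
Local Notation e1 := (e1 M). Local Notation e2 := (e2 M).
Local Notation f1 := (f1 M). Local Notation f2 := (f2 M).
Local Notation k1 := (k1 M). Local Notation k2 := (k2 M).
Local Notation k1i := (k1i M). Local Notation k2i := (k2i M).
Local Notation kc := (kc M). Local Notation kci := (kci M).
Local Notation cas := (cas M).
Local Notation y1 := (y1 M). Local Notation y2 := (y2 M q0).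
Let q2 : q ^+ 2 != 1. Proof. exact: qn1. Qed.

Local Notation f3 := (f3 M).
Local Notation e3 := (e3 M).
Local Notation G := (G M alpha).
Local Notation uqL2 := (uqL2 M alpha).


Definition whitT x := e1 x = alpha *: x /\ e2 x = 0.

Lemma whitT_subspace : subspace whitT.
Proof.
split=> [|x y [ex e2x] [ey e2y]|d x [ex e2x]]; first by split; rewrite !linear0.
  by split; rewrite !uqL2 ?ex ?ey ?e2x ?e2y ?addr0 ?scalerDr.
by split; rewrite !uqL2 ?ex ?e2x ?scaler0 // !scalerA mulrC.
Qed.

Lemma kcie1 x : kci (e1 x) = e1 (kci x).
Proof. by apply: (can_inj (kcK M)); rewrite kciK kce1 // kciK. Qed.
Lemma kcif1 x : kci (f1 x) = f1 (kci x).
Proof. by apply: (can_inj (kcK M)); rewrite kciK kcf1 // kciK. Qed.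
Lemma kcie2 x : kci (e2 x) = q ^- 3 *: e2 (kci x).
Proof.
apply: (can_inj (kcK M)); rewrite kciK uqL2 kce2 // kciK scalerA mulVf ?scale1r //.
exact: expf_neq0.
Qed.
Lemma kcif2 x : kci (f2 x) = q ^+ 3 *: f2 (kci x).
Proof.
apply: (can_inj (kcK M)); rewrite kciK uqL2 kcf2 // kciK scalerA mulfV ?scale1r //.
exact: expf_neq0.
Qed.
Lemma kcik1 x : kci (k1 x) = k1 (kci x).
Proof. by rewrite /kci !(uqE M q0). Qed.
Lemma kcik2 x : kci (k2 x) = k2 (kci x).
Proof. by rewrite /kci !(uqE M q0). Qed.
Lemma kcik1i x : kci (k1i x) = k1i (kci x).
Proof. by rewrite /kci !(uqE M q0). Qed.
Lemma kcik2i x : kci (k2i x) = k2i (kci x).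
Proof. by rewrite /kci !(uqE M q0). Qed.

Lemma y1kc x : y1 (kc x) = kc (y1 x).
Proof. by rewrite /kc !(y1k1, y1k2). Qed.
Lemma y1kci x : y1 (kci x) = kci (y1 x).
Proof. by rewrite /kci !(y1k1i, y1k2i). Qed.

Lemma scaler_inj0 (d : F) (x : V) : d != 0 -> 0 = d *: x -> x = 0.
Proof.
by move=> d0 /esym /eqP; rewrite scaler_eq0 (negPf d0) => /eqP.
Qed.

Lemma whitT_kc x : whitT x -> whitT (kc x).
Proof.
move=> [ex e2x]; split; first by rewrite -kce1 // ex uqL2.
by apply: (scaler_inj0 (expf_neq0 3 q0)); rewrite -kce2 // e2x linear0.
Qed.

Lemma whitT_kci x : whitT x -> whitT (kci x).
Proof.
move=> [ex e2x]; split; first by rewrite -kcie1 // ex uqL2.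
have q30 : q ^- 3 != 0 by rewrite invr_eq0 expf_neq0.
by apply: (scaler_inj0 q30); rewrite -kcie2 // e2x linear0.
Qed.

Let y1L := lin_fun_pushE (y1_linear M).
Let y2L := lin_fun_pushE (y2_linear M q0).

Lemma whitT_y1 x : whitT x -> whitT (y1 x).
Proof.
move=> [ex e2x]; split; first by rewrite -y1e1 // ex y1L.
have qV0 : q^-1 != 0 by rewrite invr_eq0.
by apply: (scaler_inj0 qV0); rewrite -y1e2 // e2x linear0.
Qed.

Lemma y1_whitT x : whitT x -> y1 x = cas x + q ^- 3 *: kci x.
Proof.
move=> [ex e2x]; rewrite y1E.
have -> : e2 (k1i (k2i x)) = 0.
  rewrite -(k2ik1i M) e2k2i // -[e2 (k1i x)](_ : q^-1 *: k1i (e2 x) = _).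
    by rewrite e2x !linear0.
  by rewrite (k1ie2 M q0) scalerA mulVf // scale1r.
by rewrite !(e1k2i, e2k2i, uqL2, ex, e2x) // !linear0 !(subr0, linear0, addr0).
Qed.

Lemma y2_whitT x : whitT x -> y2 x = cas x + q ^+ 3 *: kc x.
Proof.
move=> [ex e2x]; rewrite y2E // e3E.
have -> : e2 (k1 (k2 x)) = 0.
  rewrite -(k2k1 M) e2k2 // -[e2 (k1 x)](_ : q *: k1 (e2 x) = _).
    by rewrite e2x !linear0.
  by rewrite (k1e2 M) scalerA mulfV // scale1r.
by rewrite !(e1k2, e2k2, uqL2, ex, e2x) // !linear0 !(subr0, linear0, addr0).
Qed.

(** What y2 - y1 becomes on Whittaker vectors. *)
Definition ksub x := locked (q ^+ 3 *: kc x - q ^- 3 *: kci x).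
Lemma ksubE x : ksub x = q ^+ 3 *: kc x - q ^- 3 *: kci x.
Proof. by rewrite /ksub -lock. Qed.
Lemma ksub_linear : linear ksub.
Proof.
by move=> d x y; rewrite !ksubE !uqL2; lmod F; repeat split; ring.
Qed.
Let ksubL := lin_fun_pushE ksub_linear.

Lemma whitT_ksub x : whitT x -> whitT (ksub x).
Proof.
move=> wx; rewrite ksubE; apply: (subB whitT_subspace);
  apply: (subZ whitT_subspace); by [apply: whitT_kc|apply: whitT_kci].
Qed.

Lemma y2_y1 x : whitT x -> y2 x = y1 x + ksub x.
Proof.
move=> wx; rewrite y2_whitT // y1_whitT // ksubE.
by lmod F; repeat split; ring.
Qed.

Lemma ksub_y1 x : ksub (y1 x) = y1 (ksub x).
Proof. by rewrite !ksubE !y1L y1kc y1kci. Qed.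

(** On Whittaker vectors with K = kappa the operator [y1] satisfies y1^3 = mu / kappa, hence has an
    eigenvector there; as [y1] is the Casimir plus q^-3 / kappa, this is an eigenvector of the
    Casimir too. *)
Lemma whitT_eigenvector kappa x : kappa != 0 -> whitT x -> x != 0 ->
  kc x = kappa *: x -> (exists mu, forall z, y1 (y1 (y1 (kc z))) = mu *: z) ->
  exists c w, w != 0 /\ whittaker M alpha kappa c w.
Proof.
move=> kp0 wx x0 kx [mu z1].
pose S y := whitT y /\ kc y = kappa *: y.
have sS : subspace S.
  split=> [|y z [wy ky] [wz kz]|d y [wy ky]].
  - by split; [exact: sub0 whitT_subspace|rewrite linear0 scaler0].
  - split; first exact: (subD whitT_subspace).
    by rewrite uqL2 ky kz scalerDr.
  - split; first exact: (subZ whitT_subspace).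
    by rewrite uqL2 ky !scalerA mulrC.
have Sy1 y : S y -> S (y1 y).
  move=> [wy ky]; split; first exact: whitT_y1.
  by rewrite -y1kc ky y1L.
have p0 : 'X^3 - (mu / kappa)%:P != 0 :> {poly F}.
  by rewrite -size_poly_eq0 size_XnsubC.
have [|w [r [[ww kw] w0 rw]]] :=
    @eigenvector_exists F V y1 S _ x sS Sy1 (conj wx kx) x0 p0.
  rewrite -polyCN pevD pevC pevXn /= scaleNr; apply/eqP; rewrite subr_eq0.
  apply/eqP; apply: (scalerI kp0); rewrite scalerA mulrCA mulfV // mulr1.
  by rewrite -z1 kx !y1L.
exists (r - q ^- 3 / kappa), w; split=> //; have [ew e2w] := ww.
split=> //; have := y1_whitT ww; rewrite (kciE kp0 kw) => yE.
move: rw; rewrite /= yE scalerA => rw.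
by rewrite scalerBl -rw addrK.
Qed.

Section Countable.
Hypotheses (Func : uncountable F) (Msimple : simple M).
Variable B : nat -> seq V.
Hypothesis Bspan : forall x, exists n, span (fun y => y \in B n) x.

(** If [z] has no eigenvector, every z - r has a nonzero image, which by simplicity is everything;
    then all resolvents of [v] exist and [resolvent_eigenvector] gives an eigenvector after all. An
    eigenspace of [z] is a submodule, hence everything. *)
Lemma schur_dixmier (z : {linear V -> V}) :
  (forall x, z (e1 x) = e1 (z x)) -> (forall x, z (e2 x) = e2 (z x)) ->
  (forall x, z (f1 x) = f1 (z x)) -> (forall x, z (f2 x) = f2 (z x)) ->
  (forall x, z (k1 x) = k1 (z x)) -> (forall x, z (k2 x) = k2 (z x)) ->
  (forall x, z (k1i x) = k1i (z x)) -> (forall x, z (k2i x) = k2i (z x)) ->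
  exists r, forall x, z x = r *: x.
Proof.
move=> ze1 ze2 zf1 zf2 zk1 zk2 zk1i zk2i.
have [[v v0]|noV] := EM (exists v : V, v != 0); last first.
  exists 0 => x; have [->|x0] := eqVneq x 0; first by rewrite linear0 scaler0.
  by case: noV; exists x.
suff [y [r [y0 zy]]] : exists y r, y != 0 /\ z y = r *: y.
  exists r; apply: (Msimple (S := fun x => z x = r *: x)) zy y0.
  by split=> [|x zx|x zx|x zx|x zx|x zx|x zx|x zx|x zx];
    [split=> [|x t zx zt|d x zx]; rewrite ?linear0 ?scaler0 // ?linearD ?linearZ
       ?zx ?zt ?scalerDr //= !scalerA mulrC
    |rewrite (ze1,ze2,zf1,zf2,zk1,zk2,zk1i,zk2i) zx uqL2 ..].
have [//|noeig] := EM (exists y r, y != 0 /\ z y = r *: y).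
apply: (resolvent_eigenvector Func Bspan v0) => r.
apply: (Msimple (S := fun y => exists x, z x - r *: x = y) _ (x := z v - r *: v)).
- split=> [|_ [x <-]|_ [x <-]|_ [x <-]|_ [x <-]|_ [x <-]|_ [x <-]|_ [x <-]|_ [x <-]].
  + split=> [|_ _ [x <-] [y <-]|d _ [x <-]].
    * by exists 0; rewrite linear0 scaler0 subr0.
    * by exists (x + y); rewrite linearD scalerDr opprD addrACA.
    * by exists (d *: x); rewrite linearZ scalerBr !scalerA mulrC.
  + by exists (e1 x); rewrite ze1 !uqL2.
  + by exists (e2 x); rewrite ze2 !uqL2.
  + by exists (f1 x); rewrite zf1 !uqL2.
  + by exists (f2 x); rewrite zf2 !uqL2.
  + by exists (k1 x); rewrite zk1 !uqL2.
  + by exists (k2 x); rewrite zk2 !uqL2.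
  + by exists (k1i x); rewrite zk1i !uqL2.
  + by exists (k2i x); rewrite zk2i !uqL2.
- by exists v.
- by apply: contra_notN noeig; rewrite subr_eq0 => /eqP zv; exists v, r.
Qed.

(** Past E2, each [y1] contributes q^-1 and K contributes q^3, so a cube is what balances K. The
    next two lemmas rest on the same kind of count. *)
Lemma central_y1 : exists mu, forall x, y1 (y1 (y1 (kc x))) = mu *: x.
Proof.
pose z : {linear V -> V} := y1 \o (y1 \o (y1 \o kc)).
apply: (schur_dixmier (z := z)) => x; rewrite /z /=.
- by rewrite kce1 // !y1e1.
- by rewrite kce2 // !(y1L, y1e2) //; lmod F; repeat split; field.
- by rewrite kcf1 // !y1f1.
- by rewrite kcf2 // !(y1L, y1f2) //; lmod F; repeat split; field.
- by rewrite kck1 // !y1k1.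
- by rewrite kck2 // !y1k2.
- by rewrite kck1i // !y1k1i.
- by rewrite kck2i // !y1k2i.
Qed.

Lemma central_y1y2 : exists lam, forall x, y1 (y2 x) = lam *: x.
Proof.
pose z : {linear V -> V} := y1 \o y2.
apply: (schur_dixmier (z := z)) => x; rewrite /z /=.
- by rewrite y2e1 // y1e1.
- by rewrite y2e2 // y1L y1e2 // scalerA mulfV // scale1r.
- by rewrite y2f1 // y1f1.
- by rewrite y2f2 // y1L y1f2 // scalerA mulVf // scale1r.
- by rewrite y2k1 // y1k1.
- by rewrite y2k2 // y1k2.
- by rewrite y2k1i // y1k1i.
- by rewrite y2k2i // y1k2i.
Qed.

Lemma central_y2 : exists nu, forall x, y2 (y2 (y2 (kci x))) = nu *: x.
Proof.
pose z : {linear V -> V} := y2 \o (y2 \o (y2 \o kci)).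
apply: (schur_dixmier (z := z)) => x; rewrite /z /=.
- by rewrite kcie1 // !y2e1.
- by rewrite kcie2 // !(y2L, y2e2) //; lmod F; repeat split; field.
- by rewrite kcif1 // !y2f1.
- by rewrite kcif2 // !(y2L, y2f2) //; lmod F; repeat split; field.
- by rewrite kcik1 // !y2k1.
- by rewrite kcik2 // !y2k2.
- by rewrite kcik1i // !y2k1i.
- by rewrite kcik2i // !y2k2i.
Qed.

(** The source is the identity (y2 - y1)^3 + 3 y1 y2 (y2 - y1) = y2^3 - y1^3. Here y1 y2, y2^3 and
    y1^3 are lam, nu K and mu K^-1, and y2 - y1 is [ksub], so only K remains. *)
Lemma whitT_kc_eigenvector v : whitT v -> v != 0 ->
  exists kappa w, [/\ kappa != 0, whitT w, w != 0 & kc w = kappa *: w].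
Proof.
move=> wv v0; have [mu muE] := central_y1; have [lam lamE] := central_y1y2.
have [nu nuE] := central_y2.
have cubic : ksub (ksub (ksub v)) + (3%:R * lam) *: ksub v =
    nu *: kc v - mu *: kci v.
  rewrite -nuE -muE kcK kciK -scalerA -lamE.
  rewrite !y2_y1 ?(whitT_ksub, whitT_y1) //.
    rewrite !(y1L, ksubL, ksub_y1); lmod F; repeat split; ring.
  all: do ?[apply: (subD whitT_subspace) | apply: whitT_ksub | apply: whitT_y1 |
    exact: wv].
have kc_ksub x : ksub (kc x) = kc (ksub x) by rewrite !ksubE !uqL2 kcK kciK.
(* [D] is K [ksub] as a polynomial in K, and [P] is the cubic relation multiplied by K^3. *)
pose D : {poly F} := q ^+ 3 *: 'X^2 - (q ^- 3)%:P.
pose P := D * (D * D) + (3%:R * lam) *: ('X^2 * D) - nu *: 'X^4 + mu *: 'X^2.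
have pevDE x : pev kc D x = kc (ksub x).
  rewrite -kc_ksub ksubE kcK /D -polyCN pevD pevC pevZ pevXn /=.
  by rewrite scaleNr.
(* The constant term is -q^-9, whatever lam, mu and nu are. *)
have P0 : P != 0.
  have q30 : q ^+ 3 != 0 by rewrite expf_neq0.
  have : - (q ^- 3) ^+ 3 != 0 by rewrite oppr_eq0 expf_neq0 ?invr_eq0.
  apply: contraNneq => P0; have := congr1 (horner^~ 0) P0; rewrite horner0 => <-.
rewrite /P /D !(hornerD, hornerN, hornerZ, hornerXn, hornerC, hornerM) !expr0n /=.
  by apply/eqP; ring.
have Pv : pev kc P v = 0.
  rewrite /P -scaleNr !pevD !pevZ pevM pevM.
  rewrite [pev _ ('X^2 * D) _]pevM !pevDE !pevXn /= !kc_ksub.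
  transitivity (kc (kc (kc (ksub (ksub (ksub v)) + (3%:R * lam) *: ksub v -
      (nu *: kc v - mu *: kci v))))); last by rewrite cubic subrr !linear0.
  rewrite !uqL2 !kciK; lmod F; repeat split; ring.
have [|w [r [ww w0 rw]]] := eigenvector_exists whitT_subspace _ wv v0 P0 Pv.
  exact: whitT_kc.
exists r, w; split=> //; apply: contraNneq w0 => r0.
by rewrite -[w](kcK M) [kc w]rw r0 scale0r linear0.
Qed.

Lemma weight_shift kappa c w kappa' x : whittaker M alpha kappa c w -> w != 0 ->
  x != 0 -> kc x = kappa' *: x -> exists n, kappa' = q ^- (3 * n) * kappa.
Proof.
move=> ww w0 x0 kx.
have spw y : spanu M alpha w y.
  by apply: (Msimple (spanu_submod q0 qn1 a0 ww) _ w0); exact: (spanu_u M alpha w 0).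
have [s [y [us wy xE]]] := spanu_decomp (spw x).
have [t ts yt] : exists2 t, t \in s & y t != 0.
  apply: contrapT => no; move/eqP: x0; apply; rewrite xE big_seq big1 // => t ts.
  by apply/eqP; apply: contrapT => yt; apply: no; exists t => //; apply/negP.
exists t.1; apply/eqP; rewrite eq_sym -subr_eq0.
(* Components are separated modulo the zero subspace: K x - kappa' x = 0, written in components,
   makes each of its terms 0. *)
have S0 : subspace (eq (0 : V)).
  by split=> [//|_ _ <- <-|d _ <-]; rewrite ?addr0 ?scaler0.
suff /esym/eqP : 0 = (q ^- (3 * t.1) * kappa - kappa') *: y t.
  by rewrite scaler_eq0 (negPf yt) orbF.
apply: (wt_component (S := eq 0) (s := s)
  (y := fun t => (q ^- (3 * t.1) * kappa - kappa') *: y t) q0 qn1 a0 ww) => //.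
- by move=> _ <-; rewrite linear0.
- by move=> _ <-; rewrite linear0.
- by move=> t'; apply: (subZ (span_subspace _)); apply: wy.
under eq_bigr => t' _ do rewrite scalerBl -(kc_wt q0 ww (wy t')).
by rewrite sumrB -scaler_sumr -linear_sum -xE /= kx subrr.
Qed.

Lemma whittaker_kappa_uniq kappa c w kappa' c' w' :
  whittaker M alpha kappa c w -> w != 0 ->
  whittaker M alpha kappa' c' w' -> w' != 0 -> kappa = kappa'.
Proof.
move=> ww w0 ww' w0'.
have [n kn] := weight_shift ww w0 w0' (wh_kc ww').
have [m km] := weight_shift ww' w0' w0 (wh_kc ww).
have /eqP : q ^- (3 * (m + n)) * kappa = kappa.
  by rewrite {2}km kn mulrA -invfM -exprD -mulnDr.
rewrite -subr_eq0 -[X in _ - X]mul1r -mulrBl mulf_eq0 (negPf (wh_neq0 ww)) orbF.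
rewrite subr_eq0 invr_eq1 => q1; have mn : (m + n)%N = 0%N.
  by apply/eqP; apply: contraTT q1; rewrite -lt0n => mn; rewrite qn1 ?muln_gt0.
move/eqP: mn; rewrite addn_eq0 => /andP[_ /eqP n0].
by rewrite kn n0 muln0 invr1 mul1r.
Qed.

(** Whittaker vectors form a subspace stable under K and E1, so the components of [v] in the span
    generated from [w] are again Whittaker vectors. Uniqueness of [kappa] leaves degree 0 only, and
    E1 = alpha leaves K2^0 only, that is, the line of [w]. *)
Lemma whitT_whittaker v : whitT v -> v != 0 ->
  exists kappa c, whittaker M alpha kappa c v.
Proof.
move=> wv v0; have [kappa [x [kp0 wx x0 kx]]] := whitT_kc_eigenvector wv v0.
have [c [w [w0 ww]]] := whitT_eigenvector kp0 wx x0 kx central_y1.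
have spw y : spanu M alpha w y.
  by apply: (Msimple (spanu_submod q0 qn1 a0 ww) _ w0); exact: (spanu_u M alpha w 0).
have [s [y [us wy vE]]] := spanu_decomp (spw v).
have yT t : t \in s -> whitT (y t).
  move=> ts.
  apply: (wt_component (s := s) q0 qn1 a0 ww whitT_subspace _ _ us wy _ ts).
  - exact: whitT_kc.
  - by move=> z wz; rewrite wz.1; apply: (subZ whitT_subspace).
  - by rewrite -vE.
have y0 t : t \in s -> y t != 0 -> t = (0%N, 0).
  move=> ts yt; have kt := kc_wt q0 ww (wy t).
  have kpt : q ^- (3 * t.1) * kappa != 0.
    by rewrite mulf_neq0 ?invr_eq0 ?expf_neq0.
  (* [y t] need not be an eigenvector of the Casimir; [whitT_eigenvector] provides one with the same
     K-eigenvalue. *)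
  have [c' [w' [w0' ww']]] := whitT_eigenvector kpt (yT t ts) yt kt central_y1.
  have kE := whittaker_kappa_uniq ww w0 ww' w0'.
  have t1 : t.1 = 0%N.
    have /qz_inj : q ^ (3 * t.1)%N = q ^ 0%N.
      apply: invr_inj; apply: (mulIf kp0).
      by rewrite expr0z invr1 mul1r -exprnP -kE.
    by move=> /(_ q0 qn1) [] /eqP; rewrite muln_eq0 => /eqP.
  have t2 : t.2 = 0.
    apply: (qz_inj q0 qn1); rewrite expr0z; apply: (mulIf a0); rewrite mul1r.
    apply/eqP; rewrite -subr_eq0; have := (yT t ts).1.
    rewrite (e1_wt q0 qn1 ww (wy t)) => /eqP.
    by rewrite -subr_eq0 -scalerBl scaler_eq0 (negPf yt) orbF.
  by case: (t) t1 t2 => n l /= -> ->.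
have [d vd] : exists d, v = d *: w.
  have wt00 : subspace (fun x => exists d, x = d *: w).
    split=> [|_ _ [d ->] [d' ->]|d _ [d' ->]]; first by exists 0; rewrite scale0r.
      by exists (d + d'); rewrite scalerDl.
    by exists (d * d'); rewrite scalerA.
  rewrite vE big_seq; apply: (sub_sum _ wt00) => t ts.
  have [->|yt] := eqVneq (y t) 0; first by exists 0; rewrite scale0r.
  have := wy t; rewrite (y0 t ts yt); apply: (span_min wt00) => _ [a [b [ab ->]]].
  move/eqP: ab; rewrite addn_eq0 => /andP[/eqP -> /eqP ->].
  by exists 1; rewrite scale1r.
exists kappa, c; split=> //; first exact: wv.1; first exact: wv.2.
  by rewrite vd uqL2 (wh_kc ww) !scalerA mulrC.
by rewrite vd uqL2 (wh_cas ww) !scalerA mulrC.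
Qed.

Lemma critical_u_eq0 kappa c v n : whittaker M alpha kappa c v -> v != 0 ->
  (0 < n)%N -> hv q kappa c n = 0 -> u M alpha v n = 0.
Proof.
move=> wv v0 n0 hn; have [//|un0] := eqVneq (u M alpha v n) 0.
have kn := kc_u q0 wv n.
have e1n := e1_u q0 qn1 wv n; have := e2_u q0 qn1 a0 wv n.
rewrite /low hn mulr0 scale0r => e2n.
have kpn : q ^- (3 * n) * kappa != 0.
  by rewrite mulf_neq0 ?invr_eq0 ?expf_neq0 ?(wh_neq0 wv).
(* The Casimir eigenvalue of u(n) is read off from [y2], which on Whittaker vectors is the Casimir
   plus q^3 K. *)
have := y2_u q0 qn1 wv n; rewrite (y2_whitT (conj e1n e2n)) kn scalerA => casn.
have wn : whittaker M alpha (q ^- (3 * n) * kappa)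
    (q ^- n * (c + q ^+ 3 * kappa) - q ^+ 3 * (q ^- (3 * n) * kappa))
    (u M alpha v n).
  by split=> //; rewrite scalerBl -casn addrK.
have /eqP := whittaker_kappa_uniq wv v0 wn un0.
rewrite -[X in X == _]mul1r => /eqP /(mulIf (wh_neq0 wv)) /eqP.
by rewrite eq_sym invr_eq1 (negPf (qn1 _)) // muln_gt0.
Qed.

End Countable.

End SimpleModule.

(** * The explicit formula for u(n) *)

Section QTrinomial.
Variables (F : fieldType) (q alpha : F).
Hypotheses (q0 : q != 0) (qn1 : forall n, (0 < n)%N -> q ^+ n != 1).

(* Over the field R[i], qnum, qfac, qbin and acf are qint, qfact, qbinom and
   acoef. *)
Definition qnum k : F := (q ^+ k - q ^- k) / (q - q^-1).
Definition qfac k : F := \prod_(1 <= m < k.+1) qnum m.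
Definition qbin n k : F :=
  if (k <= n)%N then qfac n / (qfac k * qfac (n - k)) else 0.
(** For k + j <= n this is the q-trinomial [n]! / ([k]! [j]! [n-k-j]!), symmetric in its three
    parts, whence the three rules below for lowering one part. *)
Definition qtri n k j := qbin n k * qbin (n - k) j.

Lemma qnum_neq0 k : qnum k.+1 != 0.
Proof.
rewrite /qnum mulf_neq0 ?invr_eq0 ?(subqV_neq0 q0 qn1) //.
apply: contra (qn1 (isT : (0 < k.+1 + k.+1)%N)); rewrite subr_eq0 => /eqP qk.
by rewrite exprD {1}qk mulVf ?expf_neq0.
Qed.

Lemma qfacS k : qfac k.+1 = qfac k * qnum k.+1.
Proof. by rewrite /qfac big_nat_recr. Qed.

Lemma qfac_neq0 k : qfac k != 0.
Proof.
elim: k => [|k IHk]; first by rewrite /qfac big_geq // oner_neq0.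
by rewrite qfacS mulf_neq0 ?qnum_neq0.
Qed.

Lemma qtri_gt n k j : (n < k + j)%N -> qtri n k j = 0.
Proof.
rewrite /qtri /qbin => nkj; case: leqP => kn; last by rewrite mul0r.
by rewrite [(j <= _)%N]leqNgt ltn_subLR // nkj mulr0.
Qed.

Lemma qtriE m k j :
  qtri (m + k + j) k j = qfac (m + k + j) / (qfac k * qfac j * qfac m).
Proof.
have -> : (m + k + j = k + (j + m))%N by lia.
rewrite /qtri /qbin leq_addr !addKn leq_addr.
by field; rewrite !qfac_neq0.
Qed.

Lemma qtri_m n k j : (k + j <= n.+1)%N ->
  qtri n k j * qnum n.+1 = qtri n.+1 k j * qnum (n.+1 - (k + j)).
Proof.
rewrite leq_eqVlt => /orP[/eqP kjn|kjn].
  by rewrite qtri_gt ?kjn // subnn /qnum expr0 invr1 subrr !mul0r mulr0.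
have [m ->] : exists m, n = (m + k + j)%N by exists (n - (k + j))%N; lia.
have -> : ((m + k + j).+1 - (k + j) = m.+1)%N by lia.
rewrite -!addSn !qtriE !addSn !qfacS.
by field; rewrite !qfac_neq0 qnum_neq0.
Qed.

Lemma qtri_j n k j : qtri n k j * qnum n.+1 = qtri n.+1 k j.+1 * qnum j.+1.
Proof.
have [nkj|kjn] := ltnP n (k + j).
  by rewrite !qtri_gt ?mul0r //; lia.
have [m ->] : exists m, n = (m + k + j)%N by exists (n - (k + j))%N; lia.
rewrite -addnS !qtriE addnS !qfacS.
by field; rewrite !qfac_neq0 qnum_neq0.
Qed.

Lemma qtri_k n k j : qtri n k j * qnum n.+1 = qtri n.+1 k.+1 j * qnum k.+1.
Proof.
have [nkj|kjn] := ltnP n (k + j).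
  by rewrite !qtri_gt ?mul0r //; lia.
have [m ->] : exists m, n = (m + k + j)%N by exists (n - (k + j))%N; lia.
rewrite -addSn -addnS !qtriE addnS addSn !qfacS.
by field; rewrite !qfac_neq0 qnum_neq0.
Qed.

(** Each recurrence below changes the numerator by an even amount, so the change comes out of the
    integer division exactly. *)
Definition half n k j : int :=
  (((k%:Z) * (2 * n%:Z + 2 * j%:Z + k%:Z - 7)) %/ 2)%Z.
Definition acf n k j : F :=
  (-1) ^+ j * alpha ^+ k * (q ^+ 2 - 1) ^+ k
  * q ^ ((j%:Z) * (n%:Z - 3)) * q ^ (half n k j)
  * qbin n k * qbin (n - k) j.

Lemma half_n n k j : half n.+1 k j = half n k j + k%:Z.
Proof.
rewrite /half [RHS]addrC -divzMDl //; congr (_ %/ _)%Z.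
by rewrite -[n.+1]addn1 PoszD; ring.
Qed.

Lemma half_j n k j : half n.+1 k j.+1 = half n k j + k%:Z * 2.
Proof.
rewrite /half [RHS]addrC -divzMDl //; congr (_ %/ _)%Z.
by rewrite -[n.+1]addn1 -[j.+1]addn1 !PoszD; ring.
Qed.

Lemma half_k n k j :
  half n.+1 k.+1 j = half n k j + (k%:Z * 2 + n%:Z + j%:Z - 2).
Proof.
rewrite /half [RHS]addrC -divzMDl //; congr (_ %/ _)%Z.
by rewrite -[n.+1]addn1 -[k.+1]addn1 !PoszD; ring.
Qed.

Definition pref n k j : F := (-1) ^+ j * alpha ^+ k * (q ^+ 2 - 1) ^+ k
  * q ^ ((j%:Z) * (n%:Z - 3)) * q ^ (half n k j).

Lemma acfE n k j : acf n k j = pref n k j * qtri n k j.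
Proof. by rewrite /acf /qtri /pref !mulrA. Qed.

Lemma acf_gt n k j : (n < k + j)%N -> acf n k j = 0.
Proof. by move=> nkj; rewrite acfE qtri_gt ?mulr0. Qed.

Lemma qnum_split m k j : qnum (m + k + j) =
  q ^- (j + k) * qnum m + q ^+ (m + k) * qnum j + q ^+ m * q ^- j * qnum k.
Proof.
have [qm qk qj] : [/\ q ^+ m != 0, q ^+ k != 0 & q ^+ j != 0].
  by rewrite !expf_neq0.
rewrite /qnum !exprD; field.
by rewrite q0 qm qk qj subr_eq0 (qn1 (isT : (0 < 2)%N)).
Qed.

(** Pascal's rule for q-trinomials, with one term for each summand of [G]. After multiplication by
    [n+1] the terms on the right are the coefficient at n+1 times powers of q times [m], [j] and
    [k], where m = n+1-k-j, and [qnum_split] adds them up. *)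
Lemma acf_rec n k j : acf n.+1 k j = acf n k j
  - (if j is j'.+1 then q ^+ (2 * n + 2 * k) * q ^- 2 * acf n k j' else 0)
  + (if k is k'.+1 then alpha * (q ^+ 2 - 1) * q ^- 2 * q ^+ (2 * n + k') *
       acf n k' j else 0).
Proof.
have [nkj|kjn] := ltnP n.+1 (k + j).
  rewrite (acf_gt nkj) (acf_gt (ltnW nkj)).
  have -> : (if j is j'.+1 then q ^+ (2 * n + 2 * k) * q ^- 2 * acf n k j' else 0) = 0.
    by case: j nkj => [//|j] nkj; rewrite acf_gt ?mulr0 //; lia.
  have -> : (if k is k'.+1 then alpha * (q ^+ 2 - 1) * q ^- 2 * q ^+ (2 * n + k') *
       acf n k' j else 0) = 0.
    by case: k nkj => [//|k] nkj; rewrite acf_gt ?mulr0 //; lia.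
  by rewrite subr0 addr0.
have qz a b : q ^ (a + b) = q ^ a * q ^ b by rewrite exprzDr ?unitfE.
have [m [nE mE]] : exists m, n.+1 = (m + k + j)%N /\ (n.+1 - (k + j))%N = m.
  by exists (n.+1 - (k + j))%N; lia.
pose B := pref n.+1 k j.
have tm : acf n k j * qnum n.+1 =
    B * q ^- (j + k) * (qtri n.+1 k j * qnum m).
  rewrite acfE -mulrA qtri_m // mE /B /pref half_n qz.
  have -> : (j%:Z) * (n.+1%:Z - 3) = (j%:Z) * (n%:Z - 3) + j%:Z.
    by rewrite -[n.+1]addn1 PoszD; ring.
  rewrite qz -!exprnP exprD; field.
  by rewrite !expf_neq0.
have tj : - (if j is j'.+1 then q ^+ (2 * n + 2 * k) * q ^- 2 * acf n k j' else 0)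
    * qnum n.+1 = B * q ^+ (m + k) * (qtri n.+1 k j * qnum j).
  case: j kjn nE @B {tm mE} => [|j] kjn nE B.
    by rewrite /qnum expr0 invr1 subrr oppr0 !(mul0r, mulr0).
  rewrite mulNr -[_ * qnum n.+1]mulrA acfE -[_ * qnum n.+1]mulrA qtri_j.
  rewrite /B /pref half_j qz.
  have -> : (j.+1%:Z) * (n.+1%:Z - 3) = (j%:Z) * (n%:Z - 3) + (j%:Z + n%:Z - 2).
    by rewrite -[n.+1]addn1 -[j.+1]addn1 !PoszD; ring.
  have -> : q ^+ (2 * n + 2 * k) = q ^+ (m + k) * q ^+ j * q ^+ n * q ^+ (k * 2).
    by rewrite -!exprD; congr (_ ^+ _); lia.
  rewrite qz -PoszM -exprnP [(-1) ^+ j.+1]exprS.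
  have -> : q ^ (j%:Z + n%:Z - 2) = q ^+ j * q ^+ n * q ^- 2.
    by rewrite !qz -!exprnP.
  by field; rewrite q0.
have tk : (if k is k'.+1 then alpha * (q ^+ 2 - 1) * q ^- 2 * q ^+ (2 * n + k') *
    acf n k' j else 0) * qnum n.+1 =
    B * (q ^+ m * q ^- j) * (qtri n.+1 k j * qnum k).
  case: k kjn nE @B {tm tj mE} => [|k] kjn nE B.
    by rewrite /qnum expr0 invr1 subrr !(mul0r, mulr0).
  rewrite -[_ * qnum n.+1]mulrA acfE -[_ * qnum n.+1]mulrA qtri_k /B /pref half_k qz.
  have -> : (j%:Z) * (n.+1%:Z - 3) = (j%:Z) * (n%:Z - 3) + j%:Z.
    by rewrite -[n.+1]addn1 !PoszD; ring.
  have -> : q ^+ (2 * n + k) = q ^+ m * q ^+ j * q ^+ n * q ^+ (k * 2).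
    by rewrite -!exprD; congr (_ ^+ _); lia.
  have -> : q ^ (k%:Z * 2 + n%:Z + j%:Z - 2) = q ^+ (k * 2) * q ^+ n * q ^+ j * q ^- 2.
    by rewrite !qz -PoszM -!exprnP.
  rewrite qz -exprnP [alpha ^+ k.+1]exprS [(q ^+ 2 - 1) ^+ k.+1]exprS.
  by field; rewrite q0 expf_neq0.
apply: (mulIf (qnum_neq0 n)); rewrite !mulrDl tm tj tk acfE -/B.
rewrite -mulrA [X in qnum X]nE qnum_split.
by ring.
Qed.
End QTrinomial.

(** * Expansion of the powers of [G] in ordered monomials *)

Section Expansion.
Variables (F : fieldType) (q : F) (V : lmodType F) (M : uq_module q V).
Variable alpha : F.
Hypotheses (q0 : q != 0) (qn1 : forall n, (0 < n)%N -> q ^+ n != 1).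
Hypothesis a0 : alpha != 0.
Local Notation e1 := (e1 M). Local Notation e2 := (e2 M).
Local Notation f1 := (f1 M). Local Notation f2 := (f2 M).
Local Notation k1 := (k1 M). Local Notation k2 := (k2 M).
Local Notation k1i := (k1i M). Local Notation k2i := (k2i M).
Local Notation kc := (kc M). Local Notation kci := (kci M).
Local Notation cas := (cas M).
Local Notation y1 := (y1 M). Local Notation y2 := (y2 M q0).
Let q2 : q ^+ 2 != 1. Proof. exact: qn1. Qed.

Local Notation f3 := (f3 M).
Local Notation e3 := (e3 M).
Local Notation G := (G M alpha).
Local Notation uqL2 := (uqL2 M alpha).


Variable w : V.
Definition pbw m k j e := iter m f2 (iter k f3 (iter j k2 (iter e kci w))).

Lemma iter_comm (g h : V -> V) d : linear h ->
  (forall x, g (h x) = d *: h (g x)) ->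
  forall n x, g (iter n h x) = d ^+ n *: iter n h (g x).
Proof.
move=> hL gh; elim=> [|n IHn] x; first by rewrite scale1r.
by rewrite !iterS gh IHn (lin_fun_pushE hL) scalerA exprS.
Qed.

Lemma iter_linear (h : V -> V) n : linear h -> linear (iter n h).
Proof. by move=> hL; elim: n => [//|n IHn] d x y; rewrite !iterS IHn hL. Qed.

Let f2L n := lin_fun_pushE (iter_linear n (linearP f2)).
Lemma kci_pbw m k j e :
  kci (pbw m k j e) = q ^+ (3 * (m + k)) *: pbw m k j e.+1.
Proof.
have kf2 : forall x, kci (f2 x) = q ^+ 3 *: f2 (kci x).
  move=> x; apply: (can_inj (kcK M)); rewrite kciK uqL2 kcf2 // kciK scalerA.
  by rewrite mulfV ?scale1r ?expf_neq0.
have kf3 : forall x, kci (f3 x) = q ^+ 3 *: f3 (kci x).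
  move=> x; apply: (can_inj (kcK M)); rewrite kciK uqL2 kcf3 // kciK scalerA.
  by rewrite mulfV ?scale1r ?expf_neq0.
have kk2 : forall x, kci (k2 x) = 1 *: k2 (kci x).
  by move=> x; rewrite scale1r /kci !(uqE M q0).
rewrite /pbw (iter_comm (linearP f2) kf2) (iter_comm (f3_linear M) kf3).
rewrite (iter_comm (linearP k2) kk2) expr1n scale1r f2L scalerA -!exprM -exprD.
by rewrite -mulnDr.
Qed.

Lemma k2_pbw m k j e :
  k2 (pbw m k j e) = q ^- (2 * m + k) *: pbw m k j.+1 e.
Proof.
have kf3 x : k2 (f3 x) = q^-1 *: f3 (k2 x).
  by rewrite f3k2 // scalerA mulVf // scale1r.
rewrite /pbw (iter_comm (linearP f2) (k2f2 M)) (iter_comm (f3_linear M) kf3).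
by rewrite f2L scalerA -exprVn -exprM -exprD exprVn.
Qed.

Lemma f3_pbw m k j e : f3 (pbw m k j e) = q ^- m *: pbw m k.+1 j e.
Proof.
by rewrite /pbw (iter_comm (linearP f2) (f3f2 M q0)) exprVn.
Qed.

Lemma f2_pbw m k j e : f2 (pbw m k j e) = pbw m.+1 k j e.
Proof. by []. Qed.

Let gen n k j := pbw (n - k) k (2 * j) (2 * j + k).

Lemma G_pbw n k j : (k <= n)%N -> G (gen n k j) = gen n.+1 k j
  - (q ^+ (2 * n + 2 * k) * q ^- 2) *: gen n.+1 k j.+1
  + (alpha * (q ^+ 2 - 1) * q ^- 2 * q ^+ (2 * n + k)) *: gen n.+1 k.+1 j.
Proof.
move=> kn; have [m ->] : exists m, n = (m + k)%N by exists (n - k)%N; lia.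
rewrite /gen raiseE !(kci_pbw, k2_pbw, f3_pbw, uqL2, f2_pbw).
have [-> -> ->] : [/\ (m + k - k = m)%N, ((m + k).+1 - k = m.+1)%N &
    ((m + k).+1 - k.+1 = m)%N] by split; lia.
have [-> -> ->] : [/\ (2 * j.+1 = (2 * j).+2)%N, ((2 * j).+2 + k = (2 * j + k).+2)%N
  & (2 * j + k.+1 = (2 * j + k).+1)%N] by split; lia.
have qm : q ^+ m != 0 by rewrite expf_neq0.
have qk : q ^+ k != 0 by rewrite expf_neq0.
lmod F; repeat split; rewrite ?mulnDr ?exprD.
all: by field; rewrite ?q0 ?qm ?qk.
Qed.

Local Notation acf := (acf q alpha).

(** The sum runs over a square instead of the triangle k + j <= n, outside which [acf] is 0; the
    shifts of j and k then need no dependent bounds. *)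
Lemma G_iter_square n : iter n G w =
  \sum_(k < n.+1) \sum_(j < n.+1) acf n k j *: gen n k j.
Proof.
elim: n => [|n IHn].
  rewrite !big_ord1 acfE // /pref /half /qtri /qbin /qfac /= !big_geq //.
  by rewrite !(mul0r, expr0, div0z, mul1r, mulr1, expr0z, divr1, invr1, scale1r).
rewrite iterS IHn; have GL := G_linear M alpha.
pose a k j := acf n k j.
have aout k j : (n < k + j)%N -> a k j = 0 by exact: acf_gt.
pose Gg : {linear V -> V} := G.
have -> : G (\sum_(k < n.+1) \sum_(j < n.+1) acf n k j *: gen n k j) =
   \sum_(k < n.+1) \sum_(j < n.+1) (a k j *: gen n.+1 k j -
     (q ^+ (2 * n + 2 * k) * q ^- 2 * a k j) *: gen n.+1 k j.+1 +
     (alpha * (q ^+ 2 - 1) * q ^- 2 * q ^+ (2 * n + k) * a k j) *: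
       gen n.+1 k.+1 j).
  rewrite -[LHS]/(Gg _) linear_sum; apply: eq_bigr => k _; rewrite linear_sum.
  apply: eq_bigr => j _; rewrite linearZ -[Gg _]/(G _) G_pbw -1?ltnS //.
  by rewrite /a /= !scalerDr scalerN !scalerA ![acf n k j * _]mulrC.
pose b k j := if j is j'.+1 then q ^+ (2 * n + 2 * k) * q ^- 2 * a k j' else 0.
pose d k j := if k is k'.+1 then
  alpha * (q ^+ 2 - 1) * q ^- 2 * q ^+ (2 * n + k') * a k' j else 0.
have -> : \sum_(k < n.+2) \sum_(j < n.+2) acf n.+1 k j *: gen n.+1 k j =
    \sum_(k < n.+2) \sum_(j < n.+2) (a k j *: gen n.+1 k j -
      b k j *: gen n.+1 k j + d k j *: gen n.+1 k j).
  apply: eq_bigr => k _; apply: eq_bigr => j _.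
  by rewrite acf_rec // scalerDl scalerBl.
have split3 N (f g h : nat -> nat -> V) :
    \sum_(k < N) \sum_(j < N) (f k j - g k j + h k j) =
    \sum_(k < N) \sum_(j < N) f k j - \sum_(k < N) \sum_(j < N) g k j +
    \sum_(k < N) \sum_(j < N) h k j.
  by rewrite -sumrB -big_split; apply: eq_bigr => k _; rewrite -sumrB -big_split.
rewrite (split3 n.+1 (fun k j => a k j *: gen n.+1 k j)
  (fun k j => (q ^+ (2 * n + 2 * k) * q ^- 2 * a k j) *: gen n.+1 k j.+1)
  (fun k j => (alpha * (q ^+ 2 - 1) * q ^- 2 * q ^+ (2 * n + k) * a k j) *:
       gen n.+1 k.+1 j)).
rewrite (split3 n.+2 (fun k j => a k j *: gen n.+1 k j)
  (fun k j => b k j *: gen n.+1 k j) (fun k j => d k j *: gen n.+1 k j)).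
(* Each sum over the smaller square is compared with one over the larger square, whose additional
   row and column contribute 0. *)
congr (_ - _ + _).
- rewrite [RHS]big_ord_recr /= [X in _ = _ + X]big1 ?addr0 => [|j _]; last first.
    by rewrite aout ?scale0r // addSn ltnS leq_addr.
  apply: eq_bigr => k _; rewrite [RHS]big_ord_recr /= aout ?scale0r ?addr0 //.
  by rewrite addnS ltnS leq_addl.
- rewrite [RHS]big_ord_recr /= [X in _ = _ + X]big1 ?addr0 => [|[[|j] jn] _].
  + apply: eq_bigr => k _; rewrite [RHS]big_ord_recl /= scale0r add0r.
    by apply: eq_bigr => j _.
  + by rewrite scale0r.
  + by rewrite /= aout ?mulr0 ?scale0r // addSn ltnS leq_addr.
- rewrite [RHS]big_ord_recl /= [X in _ = X + _]big1 ?add0r => [|j _]; last first.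
    by rewrite scale0r.
  apply: eq_bigr => k _; rewrite [RHS]big_ord_recr /= aout ?mulr0 ?scale0r ?addr0 //.
  by rewrite addnS ltnS leq_addl.
Qed.

Lemma G_iterE n : iter n G w =
  \sum_(0 <= k < n.+1) \sum_(0 <= j < (n - k).+1) acf n k j *: gen n k j.
Proof.
rewrite G_iter_square big_mkord; apply: eq_bigr => k _.
rewrite big_mkord.
rewrite [RHS](big_ord_widen n.+1 (fun j => acf n k j *: gen n k j)) ?ltnS ?leq_subr //.
rewrite [RHS]big_mkcond; apply: eq_bigr => j _; case: ifP => // kj.
by rewrite acf_gt ?scale0r //; move: kj; rewrite ltnS; lia.
Qed.

End Expansion.

(** * Quotients of the free algebra by left ideals *)

Section MonoidAlgebra.
Variables (S : comNzRingType) (K : monomType).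
Local Notation A := {malg S[K]}.

Lemma scale_monalgU (c d : S) (k : K) : c *: (<< d *g k >> : A) = << c * d *g k >>.
Proof. by apply/malgP => l; rewrite mcoeffZ !mcoeffU mulrnAr. Qed.

Lemma mul_monalgU (c d : S) (k l : K) :
  (<< c *g k >> : A) * << d *g l >> = << c * d *g mmul k l >>.
Proof. by rewrite malgM_def fgmulUU. Qed.

(** This makes left multiplication linear on the quotients below. *)
Lemma malg_scalerAr (c : S) (x y : A) : c *: (x * y) = x * (c *: y).
Proof.
apply: esym; rewrite [x]monalgE [y]monalgE scaler_sumr !mulr_suml scaler_sumr.
apply: eq_bigr => k _; rewrite !mulr_sumr scaler_sumr; apply: eq_bigr => l _.
by rewrite scale_monalgU !mul_monalgU scale_monalgU mulrCA.
Qed.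
Lemma malgC_scale1 (c : S) : c%:MP = c *: 1 :> A.
Proof. by rewrite -mul_malgC mulr1. Qed.
End MonoidAlgebra.

Section FreeAlgebra.
Variable S : comNzRingType.
Local Notation FA := {malg S[{fmonom 'I_8}]}.

(** Linearity handles the coefficients of [r], and induction on the word its monomials. *)
Lemma mul_closed_of_gen (P : FA -> Prop) :
  P 0 -> (forall x y, P x -> P y -> P (x + y)) ->
  (forall c x, P x -> P (c *: x)) ->
  (forall i : 'I_8, forall x, P x -> P (<< fmu i >> * x)) ->
  forall r x, P x -> P (r * x).
Proof.
move=> P0 PD PZ Pg r x Px; rewrite [r]monalgE mulr_suml.
apply: big_ind => // k _.
have -> : (<< r@_k *g k >> : FA) = r@_k *: << k >>.
  by rewrite scale_monalgU mulr1.
rewrite -scalerAl; apply: PZ; case: k => s.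
elim: s => [|i s IHs]; first by rewrite -fmoneE mul1r.
have -> : (<< FMonom (i :: s) >> : FA) = << fmu i >> * << FMonom s >>.
  by rewrite mul_monalgU mulr1 -[mmul _ _]/(fmmul _ _) fmmulE fmuE.
by rewrite -mulrA; apply: Pg.
Qed.

End FreeAlgebra.

Section LeftQuotient.
Variables (S : fieldType) (A : lalgType S).

Definition lideal (P : A -> Prop) := [/\ P 0,
  (forall a b, P a -> P b -> P (a + b)) & (forall r a, P a -> P (r * a))].

Lemma lideal_scale (P : A -> Prop) c x : lideal P -> P x -> P (c *: x).
Proof. by move=> [_ _ PM] Px; rewrite -mulr_algl; apply: PM. Qed.

Lemma lideal_zmod (P : A -> Prop) : lideal P ->
  zmod_closed (fun x => `[<P x>]).
Proof.
move=> PL; have [P0 PD PM] := PL; split; first exact/asboolP.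
move=> x y /asboolP Px /asboolP Py; apply/asboolP; apply: (PD _ _ Px).
by rewrite -scaleN1r; apply: lideal_scale.
Qed.

Section Quotient.
Local Open Scope quotient_scope.
Variables (P : A -> Prop) (PL : lideal P).
Hypothesis mulrZ : forall (c : S) (x y : A), c *: (x * y) = x * (c *: y).

Definition lid_pred of lideal P : pred A := fun x => `[<P x>].
Definition lid_closed : zmodClosed A := 
  HB.pack_for (zmodClosed A) (lid_pred PL)
    (GRing.isZmodClosed.Build A (lid_pred PL) (lideal_zmod PL)).
Definition Vq := @Quotient.quot A lid_closed.
HB.instance Definition _ := GRing.Zmodule.on Vq.

Definition qcl (x : A) : Vq := locked (\pi_Vq x).
Lemma qclE x : qcl x = \pi_Vq x. Proof. by rewrite /qcl -lock. Qed.

Lemma qcl_eq x y : qcl x = qcl y <-> P (x - y).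
Proof.
rewrite !qclE; split=> [/eqP|Pxy]; last apply/eqP.
  by rewrite -Quotient.idealrBE => /asboolP.
by rewrite -Quotient.idealrBE; apply/asboolP.
Qed.

Lemma qcl_repr (x : Vq) : qcl (repr x) = x.
Proof. by rewrite qclE; exact: reprK. Qed.

Lemma qrepr_cl x : P (repr (qcl x) - x).
Proof. by apply/qcl_eq; rewrite qcl_repr. Qed.

Lemma qclD x y : qcl (x + y) = qcl x + qcl y.
Proof. rewrite !qclE; exact: (raddfD \pi_Vq x y). Qed.

Lemma qcl0 : qcl 0 = 0. Proof. rewrite qclE; exact: (raddf0 \pi_Vq). Qed.
Lemma qcl_eq0 x : qcl x = 0 <-> P x.
Proof. by rewrite -qcl0 qcl_eq subr0. Qed.

Lemma qclW (Q : Vq -> Prop) : (forall x, Q (qcl x)) -> forall x, Q x.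
Proof. by move=> Qcl x; rewrite -(qcl_repr x). Qed.

Definition scaleq (c : S) (x : Vq) : Vq := qcl (c *: repr x).

Lemma qscaleq_cl c x : scaleq c (qcl x) = qcl (c *: x).
Proof. by apply/qcl_eq; rewrite -scalerBr; apply: (lideal_scale _ PL (qrepr_cl x)). Qed.

Lemma scaleqA a b (x : Vq) : scaleq a (scaleq b x) = scaleq (a * b) x.
Proof. by move: x; apply: qclW => x; rewrite !qscaleq_cl scalerA. Qed.
Lemma scaleq1 : left_id 1 scaleq.
Proof. by apply: qclW => x; rewrite qscaleq_cl scale1r. Qed.
Lemma scaleqDr : right_distributive scaleq +%R.
Proof.
by move=> a; apply: qclW => x; apply: qclW => y; rewrite -qclD !qscaleq_cl -qclD scalerDr.
Qed.
Lemma scaleqDl (x : Vq) : {morph scaleq^~ x : a b / a + b}.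
Proof. by move: x; apply: qclW => x a b; rewrite !qscaleq_cl -qclD scalerDl. Qed.
HB.instance Definition _ :=
  GRing.Zmodule_isLmodule.Build S Vq scaleqA scaleq1 scaleqDr scaleqDl.

Lemma qclZ c x : qcl (c *: x) = c *: qcl x.
Proof. by rewrite -qscaleq_cl. Qed.

Definition qlact (r : A) (x : Vq) : Vq := locked (qcl (r * repr x)).

Lemma qlact_cl r x : qlact r (qcl x) = qcl (r * x).
Proof.
rewrite /qlact -lock; apply/qcl_eq; rewrite -mulrBr.
case: PL => _ _; apply; exact: qrepr_cl.
Qed.

Lemma qlactDr r (x y : Vq) : qlact r (x + y) = qlact r x + qlact r y.
Proof.
move: x y; apply: qclW => x; apply: qclW => y.
by rewrite -qclD !qlact_cl mulrDr qclD.
Qed.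

Lemma qlactZr r a (x : Vq) : qlact r (a *: x) = a *: qlact r x.
Proof. by move: x; apply: qclW => x; rewrite -qclZ !qlact_cl -mulrZ qclZ. Qed.

Lemma qlact_linear r : linear (qlact r).
Proof.
move=> a x y; apply: etrans (qlactDr r (a *: x) y) _.
by congr (_ + _); apply: qlactZr.
Qed.
Definition qlin r : {linear Vq -> Vq} :=
  HB.pack (qlact r) (GRing.isLinear.Build S Vq Vq *:%R (qlact r) (qlact_linear r)).

End Quotient.

(* The quotient is used through this record only: unification is much slower on
   the concrete type Vq. *)
Record lquot (P : A -> Prop) := Lquot {
  lq_mod : lmodType S;
  cl : A -> lq_mod;
  lact : A -> {linear lq_mod -> lq_mod};
  clD : forall x y, cl (x + y) = cl x + cl y;
  clZ : forall c x, cl (c *: x) = c *: cl x;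
  cl_eq0 : forall x, cl x = 0 <-> P x;
  clW : forall Q : lq_mod -> Prop, (forall x, Q (cl x)) -> forall x, Q x;
  lact_cl : forall r x, lact r (cl x) = cl (r * x) }.

Definition lquot_of (P : A -> Prop) (PL : lideal P)
  (mulrZ : forall (c : S) (x y : A), c *: (x * y) = x * (c *: y)) : lquot P :=
  @Lquot P (Vq PL) (qcl PL) (@qlin P PL mulrZ) (@qclD P PL) (@qclZ P PL)
    (@qcl_eq0 P PL) (@qclW P PL) (@qlact_cl P PL).

Section LquotTheory.
Variables (P : A -> Prop) (V : lquot P).
Local Notation cl := (cl V).
Local Notation lact := (lact V).

Lemma lactM r s x : lact (r * s) x = lact r (lact s x).
Proof. by move: x; apply: clW => x; rewrite !lact_cl mulrA. Qed.
Lemma lactD r s x : lact (r + s) x = lact r x + lact s x.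
Proof. by move: x; apply: clW => x; rewrite !lact_cl mulrDl clD. Qed.
Lemma lactZ c r x : lact (c *: r) x = c *: lact r x.
Proof. by move: x; apply: clW => x; rewrite !lact_cl -scalerAl clZ. Qed.
Lemma lactN r x : lact (- r) x = - lact r x.
Proof. by rewrite -[- r]scaleN1r lactZ scaleN1r. Qed.
Lemma lact1 x : lact 1 x = x.
Proof. by move: x; apply: clW => x; rewrite !lact_cl mul1r. Qed.
Lemma lactX r n x : lact (r ^+ n) x = iter n (lact r) x.
Proof.
elim: n => [|n IHn]; first by rewrite expr0 lact1.
by rewrite exprS lactM IHn iterS.
Qed.

Definition kills (r : A) := forall x, lact r x = 0.

Lemma kills_sub r s : kills (r - s) -> forall x, lact r x = lact s x.
Proof. by move=> rs x; have /eqP := rs x; rewrite lactD lactN subr_eq0 => /eqP. Qed.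

Lemma kills_cancel r s : kills (r * s - 1) -> cancel (lact s) (lact r).
Proof. by move=> /kills_sub rs x; rewrite -lactM rs lact1. Qed.

Lemma kills_conj k ki e c : kills (ki * k - 1) -> kills (k * e * ki - c *: e) ->
  forall x, lact k (lact e x) = c *: lact e (lact k x).
Proof.
move=> /kills_cancel kK /kills_sub ke x.
by have := ke (lact k x); rewrite lactZ !lactM kK.
Qed.

Lemma kills_comm a b : kills (a * b - b * a) ->
  forall x, lact a (lact b x) = lact b (lact a x).
Proof. by move=> /kills_sub ab x; rewrite -!lactM. Qed.

Lemma kills_ef e f k ki c : kills (e * f - f * e - c *: (k - ki)) ->
  forall x, lact e (lact f x) = lact f (lact e x) + c *: (lact k x - lact ki x).
Proof.
move=> /kills_sub ef x; have := ef x.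
rewrite (lactD (e * f)) (lactN (f * e)) (lactZ c) (lactD k) (lactN ki).
rewrite (lactM e f) (lactM f e) => /eqP; rewrite subr_eq => /eqP ->.
exact: addrC.
Qed.

Lemma kills_serre a b c : kills (a * a * b - c *: (a * b * a) + b * a * a) ->
  forall x, lact a (lact a (lact b x)) =
    c *: lact a (lact b (lact a x)) - lact b (lact a (lact a x)).
Proof.
move=> ab x; have := ab x.
rewrite (lactD (a * a * b - _)) (lactD (a * a * b)) (lactN (c *: _)) (lactZ c).
rewrite (lactM (a * a)) (lactM a a) (lactM (a * b)) (lactM a b).
rewrite (lactM (b * a)) (lactM b a) => /eqP.
by rewrite addr_eq0 subr_eq => /eqP ->; rewrite addrC.
Qed.

(** The relations with two E2 or two F2 are listed with e2 e2 e1 first, whereas [e122] and [f122]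
    solve for the last word. *)
Lemma kills_serre' a b c : kills (a * a * b - c *: (a * b * a) + b * a * a) ->
  forall x, lact b (lact a (lact a x)) =
    c *: lact a (lact b (lact a x)) - lact a (lact a (lact b x)).
Proof. by move=> /kills_serre ab x; rewrite ab opprB addrC subrK. Qed.

Lemma lact_lin_comb a b c c1 c2 k ki x :
  lact (a * b + c *: (c1 *: k + c2 *: ki)) x =
  lact a (lact b x) + c *: (c1 *: lact k x + c2 *: lact ki x).
Proof. by rewrite lactD lactM lactZ lactD !lactZ. Qed.

Lemma lact_qcomm a b c x : lact (a * b - c *: (b * a)) x =
  lact a (lact b x) - c *: lact b (lact a x).
Proof. by rewrite lactD lactN lactZ !lactM. Qed.

Lemma cl0 : cl 0 = 0.
Proof. by rewrite -(scale0r (0 : A)) clZ scale0r. Qed.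

Lemma cl_sum (I : Type) (r : seq I) (Q : pred I) (f : I -> A) :
  cl (\sum_(i <- r | Q i) f i) = \sum_(i <- r | Q i) cl (f i).
Proof. by apply: (big_morph cl) => [x y|]; [exact: clD|exact: cl0]. Qed.

Lemma cl_lact1 r : cl r = lact r (cl 1).
Proof. by rewrite lact_cl mulr1. Qed.

Lemma cl_eq x y : cl x = cl y <-> P (x - y).
Proof.
rewrite -(cl_eq0 V) -scaleN1r clD clZ scaleN1r.
by split=> /eqP; [rewrite -subr_eq0 => /eqP|rewrite subr_eq0 => /eqP].
Qed.

Lemma lact_eigen r c : lact r (cl 1) = c *: cl 1 <-> P (r - c *: 1).
Proof. by rewrite -cl_lact1 -clZ; apply: cl_eq. Qed.

(** The condition on a class that all its representatives lie in [Q] describes the image of [Q] in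
    the quotient without choosing representatives. *)
Lemma cl_sat (Q : A -> Prop) x : lideal Q -> (forall y, P y -> Q y) ->
  (forall y, cl y = cl x -> Q y) <-> Q x.
Proof.
move=> [_ QD _] PQ; split=> [Qx|Qx y /cl_eq /PQ Qyx]; first exact: Qx.
by rewrite -(subrK x y); apply: QD.
Qed.

Lemma sat_subspace (Q : A -> Prop) : lideal Q -> (forall y, P y -> Q y) ->
  subspace (fun v : lq_mod V => forall y, cl y = v -> Q y).
Proof.
move=> QL PQ; have QE x := cl_sat x QL PQ; have [Q0 QD QM] := QL.
split=> [|v w|c v].
- by rewrite -cl0; apply/QE.
- move: v w; apply: clW => v; apply: clW => w /QE Qv /QE Qw.
  by rewrite -clD; apply/QE/QD.
- move: v; apply: clW => v /QE Qv; rewrite -clZ; apply/QE.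
  exact: lideal_scale.
Qed.

Lemma sat_lact (Q : A -> Prop) r v : lideal Q -> (forall y, P y -> Q y) ->
  (forall y, cl y = v -> Q y) -> forall y, cl y = lact r v -> Q y.
Proof.
move=> QL PQ; have QE x := cl_sat x QL PQ; have [Q0 QD QM] := QL.
move: v; apply: clW => v /QE Qv; rewrite lact_cl; apply/QE; exact: QM.
Qed.

End LquotTheory.
End LeftQuotient.

Section Transfer.
Variables (R : realType) (q alpha : R[i]).
Hypotheses (q0 : q != 0) (qn1 : forall n, (0 < n)%N -> q ^+ n != 1).
Hypothesis a0 : alpha != 0.
Variables (P : FreeA R -> Prop) (L : @lquot R[i] {malg R[i][{fmonom 'I_8}]} P).
Hypothesis PJ : forall x, Leta q alpha x -> P x.
Local Notation lact := (lact L).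
Local Notation cl := (cl L).
Local Notation V := (lq_mod L).

Lemma kills_rel s : s \in jimbo_rels q -> kills L s.
Proof.
move=> sJ; apply: clW => x; rewrite lact_cl; apply/cl_eq0; apply: PJ.
(* Right multiplication by [x] stays in the two-sided ideal of the relations, so [s] kills every
   class and not only that of 1. *)
move=> Q Qgen _ _ _; apply: Qgen; left => Q' Q'rel _ _ _ Q'r; apply: Q'r.
exact: Q'rel.
Qed.

Lemma kills_nth i : (i < 21)%N -> kills L (nth 0 (jimbo_rels q) i).
Proof. by move=> i21; apply/kills_rel/mem_nth. Qed.

Definition quot_module : uq_module q V :=
  @UqModule R[i] q V (lact (E1 R)) (lact (E2 R)) (lact (F1 R)) (lact (F2 R))
  (lact (K1 R)) (lact (K2 R)) (lact (K1i R)) (lact (K2i R))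
  (kills_cancel (@kills_nth 1 isT)) (kills_cancel (@kills_nth 0 isT))
  (kills_cancel (@kills_nth 3 isT)) (kills_cancel (@kills_nth 2 isT))
  (fun x => esym (kills_comm (@kills_nth 4 isT) x))
  (kills_conj (@kills_nth 1 isT) (@kills_nth 5 isT))
  (kills_conj (@kills_nth 1 isT) (@kills_nth 6 isT))
  (kills_conj (@kills_nth 3 isT) (@kills_nth 7 isT))
  (kills_conj (@kills_nth 3 isT) (@kills_nth 8 isT))
  (kills_conj (@kills_nth 1 isT) (@kills_nth 9 isT))
  (kills_conj (@kills_nth 1 isT) (@kills_nth 10 isT))
  (kills_conj (@kills_nth 3 isT) (@kills_nth 11 isT))
  (kills_conj (@kills_nth 3 isT) (@kills_nth 12 isT))
  (kills_ef (@kills_nth 13 isT)) (kills_ef (@kills_nth 14 isT))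
  (kills_comm (@kills_nth 15 isT)) (kills_comm (@kills_nth 16 isT))
  (kills_serre (@kills_nth 17 isT)) (kills_serre' (@kills_nth 18 isT))
  (kills_serre (@kills_nth 19 isT)) (kills_serre' (@kills_nth 20 isT)).

Local Notation M := quot_module.

Lemma lact_Kel x : lact (Kel R) x = kc M x.
Proof. by rewrite /Kel !lactM. Qed.

Lemma lact_Kinv x : lact (Kinv R) x = kci M x.
Proof. by rewrite /Kinv !lactM /kci -(k2ik1i M) -(k2ik1i M). Qed.

Lemma lact_C1el x : (q - q^-1) ^+ 2 *: lact (C1el q) x = cas M x.
Proof.
have d0 : (q - q^-1) ^+ 2 != 0 by rewrite expf_neq0 // subqV_neq0.
have scaler_shape (F : fieldType) (W : lmodType F) (d : F) (y z : W) :
    d != 0 -> d *: (y + d^-1 *: z) = d *: y + z.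
  by move=> dn; rewrite scalerDr scalerA mulfV // scale1r.
rewrite casE -addrA -scaler_shape //; congr (_ *: _).
exact: lact_lin_comb.
Qed.

Lemma lact_F3 x : lact (F3 q) x = f3 M x.
Proof. by rewrite f3E; apply: lact_qcomm. Qed.

Lemma cl_u_el n : cl (u_el q alpha n) = u M alpha (cl 1) n.
Proof.
rewrite /u (G_iterE M q0 qn1) //.
rewrite /u_el cl_sum; apply: eq_bigr => k _; rewrite cl_sum.
apply: eq_bigr => j _; rewrite clZ; congr (_ *: _).
rewrite cl_lact1 !lactM !lactX /pbw.
by rewrite (eq_iter lact_F3) (eq_iter lact_Kinv).
Qed.

Lemma e1_cl1 : e1 M (cl 1) = alpha *: cl 1.
Proof.
apply/lact_eigen; apply: PJ; rewrite -malgC_scale1.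
by move=> Q Qgen _ _ _; apply: Qgen; right; left.
Qed.

Lemma e2_cl1 : e2 M (cl 1) = 0.
Proof.
rewrite -[LHS](cl_lact1 L); apply/cl_eq0; apply: PJ.
by move=> Q Qgen _ _ _; apply: Qgen; right; right.
Qed.

Lemma lideal_submod (Q : FreeA R -> Prop) : is_lideal Q ->
  (forall x, P x -> Q x) -> submod M (fun v => forall x, cl x = v -> Q x).
Proof.
move=> QL PQ; split; first exact: (sat_subspace L QL PQ).
all: move=> v Qv; exact: (sat_lact QL PQ Qv).
Qed.

Lemma submod_lideal S : submod M S -> is_lideal (fun x => S (cl x)).
Proof.
move=> SM; have SS := submod_sub SM; split.
- by rewrite cl0; apply: sub0 SS.
- by move=> x y Sx Sy; rewrite clD; apply: (subD SS).
apply: mul_closed_of_gen.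
- by rewrite cl0; apply: sub0 SS.
- by move=> x y Sx Sy; rewrite clD; apply: (subD SS).
- by move=> c x Sx; rewrite clZ; apply: (subZ SS).
move=> i x Sx; rewrite -lact_cl.
have -> : i = inord i by rewrite inord_val.
case: i => [[|[|[|[|[|[|[|[|//]]]]]]]] ?] /=.
- exact: (submod_e1 SM Sx).
- exact: (submod_e2 SM Sx).
- exact: (submod_f1 SM Sx).
- exact: (submod_f2 SM Sx).
- exact: (submod_k1 SM Sx).
- exact: (submod_k2 SM Sx).
- exact: (submod_k1i SM Sx).
- exact: (submod_k2i SM Sx).
Qed.

Lemma submod_cl1 S : submod M S -> S (cl 1) -> forall v, S v.
Proof.
move=> /submod_lideal [_ _ SM] S1; apply: clW => x.
by rewrite -[x]mulr1; apply: SM.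
Qed.

(** Classes of the monomials with code below n: finite lists exhausting a countable spanning set, as
    Dixmier's argument requires. *)
Definition words n : seq V :=
  [seq cl << FMonom s >> | s <- pmap (@unpickle (seq 'I_8)) (iota 0 n)].

Lemma words_span v : exists n, span (fun w => w \in words n) v.
Proof.
move: v; apply: clW => x.
exists (\max_(k <- finmap.enum_fset (msupp x)) (pickle (fmonom_val k)).+1)%N.
rewrite [x in cl x]monalgE cl_sum [\sum_(_ <- _) cl _]big_seq.
apply: (sub_sum _ (span_subspace _)) => k kx.
have -> : (<< x@_k *g k >> : FreeA R) = x@_k *: << k >>.
  by rewrite scale_monalgU mulr1.
rewrite clZ; apply: spanZ; apply: span_gen.
apply/mapP; exists (fmonom_val k); last by case: k {kx}.
rewrite mem_pmap; apply/mapP; exists (pickle (fmonom_val k)).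
  rewrite mem_iota /= add0n; 
  pose f (l : {fmonom 'I_8}) := (pickle (fmonom_val l)).+1.
  exact: (@leq_bigmax_seq {fmonom 'I_8} (finmap.enum_fset (msupp x)) xpredT f k kx isT).
by rewrite pickleK.
Qed.

End Transfer.

(** * The theorem *)

Section Ideals.
Variables (R : realType) (q alpha : R[i]).
Local Notation FA := (FreeA R).

Lemma gen_lideal_lideal (S : FA -> Prop) : is_lideal (gen_lideal S).
Proof.
split=> [|x y Sx Sy|r x Sx] Q Qgen Q0 QD QM; first exact: Q0.
  by apply: (QD); [apply: Sx|apply: Sy].
by apply: (QM); apply: Sx.
Qed.

Lemma gen_lideal_gen (S : FA -> Prop) x : S x -> gen_lideal S x.
Proof. by move=> Sx Q Qgen _ _ _; apply: Qgen. Qed.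

Lemma gen_lideal_min (S Q : FA -> Prop) : is_lideal Q ->
  (forall x, S x -> Q x) -> forall x, gen_lideal S x -> Q x.
Proof. by move=> [Q0 QD QM] SQ x; apply. Qed.

Variables (kappa c : R[i]).

Lemma Wset_Kel : Wset q alpha kappa c (Kel R - kappa%:MP).
Proof.
apply: gen_lideal_gen; right; exists 1, 0; split.
  by move=> Q _ Q1.
split; last by rewrite mul1r mul0r addr0.
by move=> Q _ Q1 QZ _ _; rewrite -(scale0r (1 : FA)); apply: QZ.
Qed.

Lemma Wset_C1el : Wset q alpha kappa c (C1el q - c%:MP).
Proof.
apply: gen_lideal_gen; right; exists 0, 1; split.
  by move=> Q _ Q1 QZ _ _; rewrite -(scale0r (1 : FA)); apply: QZ.
split; last by rewrite mul1r mul0r add0r.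
by move=> Q _ Q1.
Qed.

(** The multipliers in [Jset] stand on the left, so a left ideal has to contain only the two
    generators. *)
Lemma Wset_min (Q : FA -> Prop) : is_lideal Q ->
  (forall x, Leta q alpha x -> Q x) -> Q (Kel R - kappa%:MP) ->
  Q (C1el q - c%:MP) -> forall x, Wset q alpha kappa c x -> Q x.
Proof.
move=> QL QJ QK QC; apply: gen_lideal_min => // x [/QJ //|[r [s [_ [_ ->]]]]].
by have [_ QD QM] := QL; apply: QD; apply: QM.
Qed.

End Ideals.

Theorem theorem5p11 (R : realType) (q alpha : R[i])
  (hq0 : q != 0) (hq : forall n : nat, (0 < n)%N -> q ^+ n != 1)
  (halpha : alpha != 0) (N : FreeA R -> Prop) :
  maximal_submodule q alpha N ->
  (exists kappa c : R[i], kappa != 0 /\ ~ critical q kappa c /\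
     (forall x, N x <-> Wset q alpha kappa c x)) \/
  (exists (kappa c : R[i]) (n : nat), kappa != 0 /\ (1 <= n)%N /\
     hval q n kappa c = 0 /\
     (forall m : nat, (1 <= m)%N -> (m < n)%N -> hval q m kappa c != 0) /\
     (forall x, N x <-> Whatset q alpha kappa c n x)).
Proof.
move=> [NL NJ Nproper Nmax].
pose LN := @lquot_of R[i] {malg R[i][{fmonom 'I_8}]} N NL
  (@malg_scalerAr R[i] _).
pose MN := quot_module LN NJ.
have q2 : q ^+ 2 != 1 := hq 2%N isT.
have d0 : (q - q^-1) ^+ 2 != 0 by rewrite expf_neq0 // subqV_neq0.
have N1 : ~ N 1.
  by move=> N1; apply: Nproper => x; have [_ _ NM] := NL; rewrite -[x]mulr1; apply: NM.
have v0 : cl LN 1 != 0 by apply/eqP => /cl_eq0.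
(* The preimage of a submodule of L is a left ideal containing N, hence N or everything. *)
have Nsimple : simple MN.
  move=> S SM v Sv vn0.
  have SL := submod_lideal SM.
  have NS x : N x -> S (cl LN x).
    by move=> /cl_eq0 ->; apply: sub0 (submod_sub SM).
  have [SN|SA] := Nmax _ SL NS; last by apply: clW.
  case/eqP: vn0; move: v Sv; apply: clW => x Sx.
  by apply/cl_eq0; apply/SN.
have wv : whitT MN alpha (cl LN 1).
  by split; [exact: e1_cl1|exact: e2_cl1].
have [kappa [c' wN]] := whitT_whittaker hq0 hq halpha (@uncountable_complex R)
  Nsimple (@words_span R N LN) wv v0.
(* [whittaker] records the eigenvalue of (q - q^-1)^2 C1, the statement that of C1. *)
have [c c'E] : exists c, (q - q^-1) ^+ 2 * c = c'.
  by exists (c' / (q - q^-1) ^+ 2); rewrite mulrCA mulfV ?mulr1.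
have kp0 := wh_neq0 wN.
have hvE n : hv q kappa c' n = hval q n kappa c.
  have zD (a b : int) : q ^ (a + b) = q ^ a * q ^ b by rewrite exprzDr ?unitfE.
  rewrite /hv /hval c'E !zD -!PoszM !exprnN -!exprnP; congr (_ + _ - _).
  by rewrite [_ * q ^- 3]mulrC.
pose W := Wset q alpha kappa c.
have WL : is_lideal W by exact: gen_lideal_lideal.
have WJ x : Leta q alpha x -> W x by move=> Lx; apply: gen_lideal_gen; left.
have WN x : W x -> N x.
  apply: Wset_min => //.
    rewrite malgC_scale1; apply/(lact_eigen LN).
    by rewrite (lact_Kel NJ) (wh_kc wN).
  rewrite malgC_scale1; apply/(lact_eigen LN).
  apply: (scalerI d0); by rewrite (lact_C1el hq0 hq NJ) (wh_cas wN) scalerA c'E.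
(* The second quotient, M(eta)/W(kappa, c): the image [S] of N, which is 0 in L, is visible
   there. *)
pose LW := @lquot_of R[i] {malg R[i][{fmonom 'I_8}]} W WL
  (@malg_scalerAr R[i] _).
pose MW := quot_module LW WJ.
have wW : whittaker MW alpha kappa c' (cl LW 1).
  split; [exact: e1_cl1|exact: e2_cl1| | |exact: kp0].
    rewrite -[LHS](lact_Kel WJ); apply/(lact_eigen LW); rewrite -malgC_scale1.
    exact: Wset_Kel.
  have C1E : lact LW (C1el q) (cl LW 1) = c *: cl LW 1.
    by apply/(lact_eigen LW); rewrite -malgC_scale1; apply: Wset_C1el.
  apply: etrans (esym (lact_C1el hq0 hq WJ (cl LW 1))) _.
  apply: etrans (congr1 _ C1E) _.
  apply: etrans (scalerA _ _ _) _.
  exact: (congr1 (fun t => t *: cl LW 1) c'E).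
have spW v : spanu MW alpha (cl LW 1) v.
  apply: (submod_cl1 (spanu_submod hq0 hq halpha wW)).
  exact: (spanu_u MW alpha (cl LW 1) 0).
pose S v := forall x, cl LW x = v -> N x.
have SM : submod MW S by exact: lideal_submod.
have SE x : S (cl LW x) <-> N x by exact: (cl_sat LW x NL WN).
(* The descent cannot end at u(0), the class of 1, because N is proper. *)
have uSN b : S (u MW alpha (cl LW 1) b) -> exists2 n, (n <= b)%N &
    (0 < n)%N /\ hval q n kappa c = 0.
  move=> Sb; have [n nb [Sn [n0|hn]]] := submod_u_descent hq0 hq halpha wW SM Sb.
    by move: Sn; rewrite n0 => /(SE 1).
  exists n => //; split; last by rewrite -hvE.
  by case: n {nb hn} Sn => // /(SE 1).
have [crit|ncrit] := EM (critical q kappa c); last first.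
  left; exists kappa, c; split=> //; split=> // x; split=> [Nx|]; last exact: WN.
  apply/(cl_eq0 LW); have Sx : S (cl LW x) by apply/SE.
  move: (cl LW x) (submod_spanu hq0 hq halpha wW SM Sx (spW _)) => v.
  elim=> {v} // [y [l [a [b [/uSN [n _ [n1 hn]] _]]]]|y z _ -> _ ->|d y _ ->].
  - by case: ncrit; exists n.
  - by rewrite addr0.
  - by rewrite scaler0.
right; have [n0 [n01 /eqP hn0]] := crit.
have exn : exists n, (0 < n)%N && (hval q n kappa c == 0).
  by exists n0; rewrite n01.
case: (ex_minnP exn) => n /andP[n1 /eqP hn] nmin.
exists kappa, c, n; split=> //; split=> //; split=> //; split=> [m m1 mn|].
  by apply: contraTneq mn => hm; rewrite -leqNgt nmin // m1 hm eqxx.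
have uN : N (u_el q alpha n).
  apply/(cl_eq0 LN); rewrite (cl_u_el hq0 hq halpha LN NJ).
  apply: (critical_u_eq0 hq0 hq halpha Nsimple wN v0 n1).
  by rewrite hvE.
have HL : is_lideal (Whatset q alpha kappa c n) by exact: gen_lideal_lideal.
have WH x : W x -> Whatset q alpha kappa c n x.
  by move=> Wx; apply: gen_lideal_gen; left.
move=> x; split=> [Nx|]; last first.
  by apply: gen_lideal_min => // y [/WN|->].
pose T v := forall y, cl LW y = v -> Whatset q alpha kappa c n y.
have TM : submod MW T by exact: lideal_submod.
have TE y : T (cl LW y) <-> Whatset q alpha kappa c n y.
  exact: (cl_sat LW y HL WH).
(* u(b) arises from u(n) by b - n applications of [G], each summand of which preserves [T]. *)
have Tu b : (n <= b)%N -> T (u MW alpha (cl LW 1) b).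
  move=> /subnK <-; elim: (b - n)%N => [|k IHk].
    rewrite add0n -(cl_u_el hq0 hq halpha LW WJ); apply/TE.
    by apply: gen_lideal_gen; right.
  rewrite addSn uS raiseE; have sT := submod_sub TM.
  have Tkci y : T y -> T (kci MW y).
    by move=> Ty; rewrite /kci; apply: (submod_k1i TM); do 2 apply: (submod_k2i TM).
  apply: (subD sT); first apply: (subB sT).
  - exact: (submod_f2 TM).
  - apply: (subZ sT); apply: (submod_f2 TM); do 2 apply: (submod_k2 TM).
    by do 2 apply: (Tkci).
  - apply: (subZ sT); rewrite f3E; apply: (subB sT); last apply: (subZ sT).
      by apply: (submod_f1 TM); apply: (submod_f2 TM); apply: (Tkci).
    by apply: (submod_f2 TM); apply: (submod_f1 TM); apply: (Tkci).
apply/TE; have Sx : S (cl LW x) by apply/SE.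
apply: (span_min (submod_sub TM) _ (submod_spanu hq0 hq halpha wW SM Sx (spW _))).
move=> _ [l [a [b [Sb ->]]]].
apply: (submod_k2z TM); apply: (submod_f2X TM); apply: Tu.
have [m mb [m1 hm]] := uSN b Sb; apply: leq_trans mb; apply: nmin.
by rewrite m1 hm eqxx.
Qed.
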